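(* Let $T$ be a complete first-order theory with an infinite model and let $\mathcal{M}$ be a monster model of $T$. Let $\kappa,\kappa_0,\kappa_1$ be cardinals with $\kappa+1=\kappa_0+\kappa_1$. Let $x=x_0x_1$ be a finite tuple of variables split into two subtuples $x_0$ and $x_1$. Suppose there is an ird-pattern of width $\kappa$ witnessed by formulas $\varphi_i(x;y_i)$ $(i\in\kappa)$. Then there is $l\in\{0,1\}$ and there are formulas $\psi_i(x_l;y'_i)$ $(i\in\kappa_l)$ together with tuples $c_{i,j}$ $(i\in\kappa_l, j\in\omega)$ such that $\langle(\psi_i(x_l;y'_i))_{i\in\kappa_l},(c_{i,j})_{i\in\kappa_l,j\in\omega}\rangle$ is an ird-pattern of width $\kappa_l$.
   Context: For a formula $\varphi$ and a condition $( * )$, $\varphi^{\text{if }( * )}$ denotes $\varphi$ if $( * )$ is true and $\neg\varphi$ if $( * )$ is false. Given a cardinal $\kappa$, formulas $\varphi_i(x;y_i)$ $(i\in\kappa)$ (all in the same variable tuple $x$) and tuples $b_{i,j}$ $(i\in\kappa,j\in\omega)$ in $\mathcal{M}$ with $|b_{i,j}|=|y_i|$, the pair $\langle(\varphi_i(x;y_i))_{i\in\kappa},(b_{i,j})_{i\in\kappa,j\in\omega}\rangle$ is an ird-pattern of width $\kappa$ if for every $\eta\in\omega^\kappa$, the set $\{\varphi_i(x;b_{i,j})^{\text{if }(j\geq\eta(i))}: i\in\kappa,j\in\omega\}$ is consistent. *)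

(* Defs.v *)
From mathcomp Require Import all_boot.
From mathcomp Require Import mathcomp_extra boolp classical_sets functions cardinality.

Set Implicit Arguments.
Unset Strict Implicit.
Unset Printing Implicit Defensive.

Local Open Scope classical_set_scope.
Local Open Scope card_scope.

(* Cardinals are represented by types; [[set: K]] has the cardinality of K. *)
Definition card_lt (T U : Type) (A : set T) (B : set U) : Prop :=
  A #<= B /\ ~ (B #<= A).
Notation "A '#<' B" := (card_lt A B) (at level 79) : card_scope.

(* Constant symbols are function symbols of arity 0. *)
Record language : Type := Language {
  fsym : Type;
  farity : fsym -> nat;
  rsym : Type;
  rarity : rsym -> nat
}.

(* [term L V] and [formula L V] are the L-terms and L-formulas whose free
   variables are taken from the type V.  In [Ex phi] the bound variable is
   [None : option V]. *)
Inductive term (L : language) (V : Type) : Type :=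
| Var of V
| App (f : fsym L) of ('I_(farity f) -> term L V).

Inductive formula (L : language) (V : Type) : Type :=
| Eq of term L V & term L V
| Rel (r : rsym L) of ('I_(rarity r) -> term L V)
| Not of formula L V
| And of formula L V & formula L V
| Ex of formula L (option V).

Definition sentence (L : language) : Type := formula L void.

Record structure (L : language) : Type := Structure {
  dom :> Type;
  dom_inhabited : inhabited dom;
  fint : forall f : fsym L, ('I_(farity f) -> dom) -> dom;
  rint : forall r : rsym L, ('I_(rarity r) -> dom) -> Prop
}.

Section Semantics.
Variables (L : language) (M : structure L).

Fixpoint eval (V : Type) (e : V -> M) (t : term L V) : M :=
  match t with
  | Var v => e v
  | App f ts => fint (fun k => eval e (ts k))
  end.

Definition env_cons (V : Type) (m : M) (e : V -> M) (v : option V) : M :=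
  if v is Some w then e w else m.

Fixpoint sat (V : Type) (phi : formula L V) : (V -> M) -> Prop :=
  match phi with
  | Eq t1 t2 => fun e => eval e t1 = eval e t2
  | Rel r ts => fun e => rint (fun k => eval e (ts k))
  | Not psi => fun e => ~ sat psi e
  | And psi1 psi2 => fun e => sat psi1 e /\ sat psi2 e
  | Ex psi => fun e => exists m : M, sat psi (env_cons m e)
  end.

Definition holds (s : sentence L) : Prop :=
  sat s (fun v : void => match v with end).

Definition models (T : set (sentence L)) : Prop := forall s, T s -> holds s.

End Semantics.

Definition entails (L : language) (T : set (sentence L)) (s : sentence L) :
    Prop :=
  forall N : structure L, models N T -> holds N s.

Definition complete_theory (L : language) (T : set (sentence L)) : Prop :=
  (exists N : structure L, models N T) /\
  (forall s : sentence L, entails T s \/ entails T (Not s)).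

(* Joins values for the variables x (type X) and y (type Y) into values for
   the variables of a formula phi(x; y) in [formula L (X + Y)]. *)
Definition env_join (X Y D : Type) (a : X -> D) (b : Y -> D) (v : X + Y) : D :=
  match v with inl u => a u | inr w => b w end.

Section OverModel.
Variables (L : language) (M : structure L).

(* A formula over M in the variables X: an L-formula phi(x; y) together with a
   tuple b of elements of M substituted for y, i.e. phi(x; b). *)
Record pformula (X : Type) : Type := PFormula {
  par_len : nat;
  par_form : formula L (X + 'I_par_len);
  par : 'I_par_len -> M
}.

Definition psat (X : Type) (p : pformula X) (a : X -> M) : Prop :=
  sat (par_form p) (env_join a (@par X p)).

(* Consistency of a set of formulas over M (i.e. consistency with the
   elementary diagram of M) is finite satisfiability in M. *)
Definition consistent (X : Type) (S : set (pformula X)) : Prop :=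
  forall F : set (pformula X), F `<=` S -> finite_set F ->
    exists a : X -> M, forall p, F p -> psat p a.

Definition realized (X : Type) (S : set (pformula X)) : Prop :=
  exists a : X -> M, forall p, S p -> psat p a.

Definition over (X : Type) (A : set M) (S : set (pformula X)) : Prop :=
  forall p, S p -> forall k, A (@par X p k).

Definition saturated (Kbar : Type) : Prop :=
  forall A : set M, A #< [set: Kbar] ->
  forall (n : nat) (S : set (pformula 'I_n)),
    over A S -> consistent S -> realized S.

Definition partial_elementary (A : set M) (f : M -> M) : Prop :=
  forall (n : nat) (phi : formula L 'I_n) (a : 'I_n -> M),
    (forall k, A (a k)) -> (sat phi a <-> sat phi (f \o a)).

Definition automorphism (g : M -> M) : Prop :=
  [/\ bijective g,
      forall (f : fsym L) (a : 'I_(farity f) -> M),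
        g (fint a) = fint (g \o a) &
      forall (r : rsym L) (a : 'I_(rarity r) -> M),
        rint a <-> rint (g \o a)].

Definition strongly_homogeneous (Kbar : Type) : Prop :=
  forall (A : set M) (f : M -> M), A #< [set: Kbar] ->
    partial_elementary A f ->
    exists2 g : M -> M, automorphism g & forall m, A m -> g m = f m.

(* [|T|] is the number of L-formulas. *)
Definition monster (T : set (sentence L)) (Kbar : Type) : Prop :=
  [/\ models M T,
      [set: formula L nat] #< [set: Kbar],
      saturated Kbar &
      strongly_homogeneous Kbar].

(* phi^{if c} *)
Definition form_if (V : Type) (phi : formula L V) (c : bool) : formula L V :=
  if c then phi else Not phi.

Definition ird_pattern (X K : Type) (q : K -> nat)
    (phi : forall i : K, formula L (X + 'I_(q i)))
    (b : forall i : K, nat -> 'I_(q i) -> M) : Prop :=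
  forall eta : K -> nat,
    consistent (range (fun ij : K * nat =>
      PFormula (form_if (phi ij.1) (eta ij.1 <= ij.2)) (b ij.1 ij.2))).

Definition has_ird_pattern (X K : Type) : Prop :=
  exists (q : K -> nat)
         (phi : forall i : K, formula L (X + 'I_(q i)))
         (b : forall i : K, nat -> 'I_(q i) -> M),
    ird_pattern phi b.

End OverModel.

(* Main.v *)
(* Write an ird-pattern as an array J whose row i is a sequence cut by
   phi_i(a; -), a = a0 a1.  Passing to generic indices (iterated ultrafilter
   quantifiers) and using saturation, one may index the rows by the rationals so
   that the rows are mutually indiscernible, phi_i(a; -) cuts J i exactly at 0,
   and the halves (p < 0 and 0 <= p) of all the rows are mutually indiscernible
   over a.  Let X be the set of the rows that a0 cuts, i.e. that are not
   indiscernible over a0 and the halves of the other rows.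
   - Each row i of X has a formula theta_i(a0, d_i; -) cutting it at 0, whose
     parameters d_i lie in the array, at indices of absolute value at least 1.
     Shifting the rows independently by less than 1 moves the cuts along the
     indices in [0, 1[ but not past the d_i; so the theta_i form an ird-pattern
     in x0, of width |X|.
   - The rows outside X are mutually indiscernible over a0, so that the single
     pattern realized by a1 in phi_i(a0, x1; -) gives all the others: these
     formulas form an ird-pattern in x1, of width |~X|.
   Finally kappa + 1 = kappa0 + kappa1 yields kappa0 <= |X| or kappa1 <= |~X|. *)

Require Import Defs.
From mathcomp Require Import all_boot all_order all_algebra.
From mathcomp Require Import mathcomp_extra boolp classical_sets functions cardinality.
From mathcomp Require Import filter lra.

Set Implicit Arguments.
Unset Strict Implicit.
Unset Printing Implicit Defensive.

Import Order.TTheory GRing.Theory Num.Theory.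

Local Open Scope classical_set_scope.
Local Open Scope card_scope.

(** * Cardinals *)

Definition embeds (T U : Type) : Prop := exists f : T -> U, injective f.

Lemma card_le_embeds (T U : Type) : ([set: T] #<= [set: U]) <-> embeds T U.
Proof.
split=> [/card_leP[f]|[f finj]].
  pose to (x : T) : [set: T] := SigSub (mem_set (I : [set: T] x)).
  exists (fun x => val (f (to x))) => x y /val_inj /inj fxy.
  by have /(congr1 val) := fxy (mem_set I) (mem_set I).
have /card_leP : $|{injfun [set: [set: T]] >-> [set: [set: U]]}|.
  apply/injfunPex.
  exists (fun x => SigSub (mem_set (I : [set: U] (f (val x))))) => //.
  by move=> x y _ _ /(congr1 val) /finj /val_inj.
by [].
Qed.

Lemma embeds_trans (T U V : Type) : embeds T U -> embeds U V -> embeds T V.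
Proof. by move=> [f fi] [g gi]; exists (g \o f); exact: inj_comp. Qed.

(** Zorn's lemma on graphs of partial injections: a maximal graph is total on one side, since
    otherwise a pair of uncovered points could be added. *)
Lemma embeds_total (T U : Type) : embeds T U \/ embeds U T.
Proof.
pose P (G : set (T * U)) := forall u v, G u -> G v -> (u.1 = v.1 <-> u.2 = v.2).
have [F FP Ftot|G [GP Gmax]] := @Zorn_bigcup _ P.
  move=> u v [X FX Xu] [Y FY Yv].
  have [XY|YX] := Ftot _ _ FX FY; first exact: (FP _ FY) (XY _ Xu) Yv.
  exact: (FP _ FX) Xu (YX _ Yv).
have [domG|/existsNP[t tG]] := pselect (forall t, exists u, G (t, u)).
  left; have [f fG] := choice domG; exists f => x y e.
  exact: (proj2 (GP _ _ (fG x) (fG y))).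
have [ranG|/existsNP[u uG]] := pselect (forall u, exists t, G (t, u)).
  right; have [f fG] := choice ranG; exists f => x y e.
  exact: (proj1 (GP _ _ (fG x) (fG y))).
case: (Gmax (G `|` [set (t, u)])).
  split; first by left.
  by move=> sub; case: tG; exists u; apply: sub; right.
move=> [a b] [c d] /=.
have NG x y : G (x, y) -> x <> t /\ y <> u.
  by move=> Gxy; split=> e; subst; [apply: tG; exists y|apply: uG; exists x].
move=> [Gab|[-> ->]] [Gcd|[-> ->]] //; first exact: GP Gab Gcd.
  by have [? ?] := NG _ _ Gab.
by have [? ?] := NG _ _ Gcd; split=> /esym.
Qed.

(** A point sent to [None] is redirected to [f None], which by injectivity is then not [None] and
    not yet a value. *)
Lemma embeds_option (T U : Type) : embeds (option T) (option U) -> embeds T U.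
Proof.
move=> [f finj].
have H (x : T) : exists y, Some y = if f (Some x) is Some z then Some z else f None.
  case E: (f (Some x)) => [z|]; first by exists z.
  case E': (f None) => [z|]; first by exists z.
  by have := finj _ _ (etrans E (esym E')).
have [g gE] := choice H; exists g => x y e; have := congr1 Some e; rewrite !gE.
case Ex: (f (Some x)) => [a|]; case Ey: (f (Some y)) => [b|].
- by rewrite -Ex -Ey => /finj[].
- by rewrite -Ex => /finj.
- by rewrite -Ey => /finj.
- by case: (finj _ _ (etrans Ex (esym Ey))).
Qed.

(** By comparability [U] injects into [T]. The injection misses a point, for otherwise its inverse
    would embed [T] into [U]; [None] goes to that point. *)
Lemma not_embeds_option (T U : Type) : ~ embeds T U -> embeds (option U) T.
Proof.
move=> NTU; case: (embeds_total T U) => // -[f finj].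
have [surj|/existsNP[t Nt]] := pselect (forall t, exists u, f u = t).
  case: NTU; have [g gK] := choice surj; exists g.
  exact: can_inj gK.
exists (fun o => if o is Some u then f u else t) => -[u|] [v|] //.
- by move/finj->.
- by move=> e; case: Nt; exists u.
- by move=> e; case: Nt; exists v.
Qed.

(** The orbit of [f None] under [f \o Some] never repeats. *)
Lemma embeds_option_nat (T : Type) : embeds (option T) T -> embeds nat T.
Proof.
move=> [f finj]; pose g n := iter n (f \o Some) (f None).
exists g; elim=> [|m IH] [|n] //=.
- by move/finj.
- by move/finj.
- by move=> /finj[/IH->].
Qed.

(** Hilbert's hotel: the points of the sequence [u] move up by one and free [u 0] for [None]. *)
Lemma embeds_nat_option (T : Type) : embeds nat T -> embeds (option T) T.
Proof.
move=> [u uinj].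
have K (x : T) : {n | u n = x} + {forall n, u n <> x}.
  have [/cid[n e]|H] := pselect (exists n, u n = x); first by left; exists n.
  by right=> n e; apply: H; exists n.
pose f (o : option T) :=
  if o is Some x then if K x is inleft n then u (sval n).+1 else x else u 0.
exists f => -[x|] [y|] //; rewrite /f.
- case: (K x) => [[m mx]|Nx]; case: (K y) => [[n ny]|Ny] /=.
  + by move/uinj => [mn]; rewrite -mx -ny mn.
  + by move/Ny.
  + by move/esym/Nx.
  + by move->.
- case: (K x) => [[m mx]|Nx] /=; first by move/uinj.
  by move/esym/Nx.
- case: (K y) => [[n ny]|Ny] /=; first by move/uinj.
  by move/Ny.
Qed.

(** Zorn's lemma gives a maximal family of injective sequences with disjoint ranges. They miss at
    most countably many points, so [T] embeds into the family times [nat], which absorbs a further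
    factor [nat] and embeds back into [T]. *)
Lemma embeds_prod_nat (T : Type) : embeds nat T -> embeds (T * nat) T.
Proof.
move=> [u0 u0inj].
pose P (F : set (nat -> T)) := forall u v, F u -> F v ->
  forall m n, u m = v n -> u = v /\ m = n.
have [F FP Ftot|F [FP Fmax]] := @Zorn_bigcup _ P.
  move=> u v [X FX Xu] [Y FY Yv].
  have [XY|YX] := Ftot _ _ FX FY; first exact: (FP _ FY) (XY _ Xu) Yv.
  exact: (FP _ FX) Xu (YX _ Yv).
pose covered x := exists un : {u | F u} * nat, sval un.1 un.2 = x.
have sub1 : embeds ({u | F u} * nat) T.
  exists (fun un => sval un.1 un.2) => -[[u Fu] m] [[v Fv] n] /= e.
  have [uv mn] := FP _ _ Fu Fv _ _ e.
  by rewrite mn; congr (_, _); apply: eq_exist.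
(* Otherwise [nat] would embed into the uncovered points, and this sequence would enlarge the
   family. *)
have rest : embeds {x | ~ covered x} nat.
  case: (embeds_total {x | ~ covered x} nat) => // -[w winj]; exfalso.
  pose w' n := sval (w n).
  have w'inj : injective w' by move=> m n /eq_sig_hprop /winj; apply.
  have Nw v m n : F v -> v n <> w' m.
    by move=> Fv e; apply: (svalP (w m)); exists (exist _ v Fv, n).
  apply: (Fmax (F `|` [set w'])).
    split; first by left.
    by move=> /(_ w' (or_intror erefl)) Fw; exact: (Nw w' 0 0).
  move=> u v [Fu|->] [Fv|->] m n.
  - exact: FP.
  - by move/Nw => /(_ Fu).
  - by move/esym/Nw => /(_ Fv).
  - by move/w'inj.
have [r rinj] := rest.
have [u1 Fu1] : exists u, F u.
  apply: contrapT => /forallNP F0; apply: (Fmax [set u0]).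
    by split=> [u /F0 //|/(_ u0 erefl)]; apply: F0.
  by move=> u v -> -> m n /u0inj.
(* Covered points take the even positions of their sequence; the countably many others take the odd
   positions of one fixed sequence [u1]. *)
have sub2 : embeds T ({u | F u} * nat).
  have cov x : {un : {u | F u} * nat | sval un.1 un.2 = x} + {~ covered x}.
    by have [/cid|] := pselect (covered x); [left|right].
  exists (fun x => match cov x with
    | inleft (exist un _) => (un.1, un.2.*2)
    | inright Nx => (exist _ u1 Fu1, (r (exist _ x Nx)).*2.+1)
    end) => x y.
  case: (cov x) => [[[u m] xE]|Nx]; case: (cov y) => [[[v n] yE]|Ny] /=.
  - by move=> [uv /double_inj mn]; rewrite -xE -yE uv mn.
  - by move=> [_ /(congr1 odd)]; rewrite /= !odd_double.
  - by move=> [_ /(congr1 odd)]; rewrite /= !odd_double.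
  - by move=> [/double_inj /rinj e]; have := congr1 sval e.
apply: embeds_trans sub1; have [f finj] := sub2.
exists (fun x => ((f x.1).1, pickle ((f x.1).2, x.2))) => -[x m] [y n] /=.
move=> [e1 /(pcan_inj pickleK) [e2 ->]]; congr (_, _); apply: finj.
by case: (f x) (f y) e1 e2 => ? ? [? ?] /= -> ->.
Qed.

Lemma embeds_prod_countable (T C : Type) : embeds C nat ->
  embeds (T * C) T \/ embeds (T * C) nat.
Proof.
move=> [c cinj]; have [[f finj]|natT] := embeds_total T nat.
  right; exists (fun x => pickle (f x.1, c x.2)).
  by move=> [x m] [y n] /(pcan_inj pickleK) [/finj -> /cinj ->].
left; apply: embeds_trans (embeds_prod_nat natT).
by exists (fun x => (x.1, c x.2)) => -[x m] [y n] [-> /cinj ->].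
Qed.

Lemma embeds_nat_split (K : Type) (X : set K) :
  embeds nat K -> embeds nat {i | X i} \/ embeds nat {i | ~ X i}.
Proof.
move=> [u uinj].
have toset (Y : set K) : ~ finite_set [set n | Y (u n)] -> embeds nat {i | Y i}.
  move=> /infiniteP /pcard_leP [f].
  have Yf n : Y (u (f n)) by exact: (@funS _ _ _ _ f n I).
  exists (fun n => exist Y (u (f n)) (Yf n)) => m n /(congr1 sval) /= /uinj.
  by move=> /inj; apply; exact: mem_set.
have [finX|/toset] := pselect (finite_set [set n | X (u n)]); last by left.
have [finY|/(toset (~` X))] := pselect (finite_set [set n | ~ X (u n)]); last by right.
case: infinite_nat; apply: (@card_le_finite _ _ _
  ([set n | X (u n)] `|` [set n | ~ X (u n)])); last by rewrite finite_setU.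
by apply: subset_card_le => n _; exact: lem.
Qed.

(** If both embeddings fail, then [|X| + 1 <= K0] and [|~X| + 1 <= K1], which forces [K] to be
    infinite. The larger of [X] and [~X] then has the size of [K], hence room for [K0 + K1], a
    contradiction. *)
Lemma sum_cardinal_split (K K0 K1 : Type) (X : set K) :
  embeds (K0 + K1) (option K) -> embeds (option K) (K0 + K1) ->
  embeds K0 {i | X i} \/ embeds K1 {i | ~ X i}.
Proof.
move=> le01K leK01; apply: contrapT => /not_orP[N0 N1].
have [f finj] := not_embeds_option N0; have [g ginj] := not_embeds_option N1.
have XC i : {X i} + {~ X i} by exact: pselect.
(* The points [f None] and [g None] give [K + 2 <= K0 + K1 <= K + 1]. *)
have natK : embeds nat K.
  apply: embeds_option_nat; apply: embeds_option; apply: embeds_trans le01K.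
  exists (fun o => match o with
    | None => inl (f None) | Some None => inr (g None)
    | Some (Some i) => match XC i with
      left h => inl (f (Some (exist _ i h))) | right h => inr (g (Some (exist _ i h)))
      end end).
  move=> [[i|]|] [[j|]|] //=.
  - by case: (XC i) => ?; case: (XC j) => ? // []; [move/finj => [->]|move/ginj => [->]].
  - by case: (XC i) => ? // [] /ginj.
  - by case: (XC i) => ? // [] /finj.
  - by case: (XC j) => ? // [] /ginj.
  - by case: (XC j) => ? // [] /finj.
have le1 (Y : set K) (T : Type) : embeds nat {i | Y i} -> embeds T (K0 + K1) ->
    embeds K ({i | Y i} * nat) -> embeds T {i | Y i}.
  move=> natY T01 KY; apply: embeds_trans (embeds_prod_nat natY).
  apply: embeds_trans KY; apply: embeds_trans (embeds_nat_option natK).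
  exact: embeds_trans le01K.
have K0i : embeds K0 (K0 + K1) by exists inl => ? ? [].
have K1i : embeds K1 (K0 + K1) by exists inr => ? ? [].
have K_le_double (Y Z : set K) : (forall i, Y i \/ Z i) ->
    embeds {i | Y i} {i | Z i} -> embeds K ({i | Z i} * nat).
  move=> YZ [h hinj].
  have YC i : {Y i} + {~ Y i} by exact: pselect.
  have YZ' i : ~ Y i -> Z i by case: (YZ i).
  exists (fun i => match YC i with
    | left y => (h (exist _ i y), 0) | right y => (exist _ i (YZ' i y), 1) end).
  move=> i j; case: (YC i) => yi; case: (YC j) => yj // [].
    by move/hinj => [].
  by [].
have inf (Y Z : set K) : embeds {i | Y i} {i | Z i} ->
    embeds nat {i | Y i} \/ embeds nat {i | Z i} -> embeds nat {i | Z i}.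
  by move=> YZ [] // H; exact: embeds_trans YZ.
have [XY|YX] := embeds_total {i | X i} {i | ~ X i}.
  case: N1; apply: le1 => //; last by apply: K_le_double XY => i; exact: lem.
  exact: inf XY (embeds_nat_split X natK).
case: N0; apply: le1 => //; last by apply: K_le_double YX => i; rewrite orC; exact: lem.
by apply: inf YX _; rewrite orC; exact: embeds_nat_split.
Qed.

Lemma card_lt_embeds (T U V : Type) : embeds T U ->
  [set: U] #< [set: V] -> [set: T] #< [set: V].
Proof.
move=> TU [/card_le_embeds UV NVU]; split; first exact/card_le_embeds/embeds_trans/UV.
by move=> /card_le_embeds VT; apply/NVU/card_le_embeds/embeds_trans/TU.
Qed.

Lemma card_lt_option_prod (K C Kbar : Type) : embeds C nat ->
  [set: nat] #< [set: Kbar] -> [set: K] #< [set: Kbar] ->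
  [set: (option K * C)%type] #< [set: Kbar].
Proof.
move=> Cnat ltnat ltK; have [H|H] := embeds_prod_countable (option K) Cnat.
  have [[f finj]|natK] := embeds_total K nat.
    apply: card_lt_embeds ltnat; apply: embeds_trans H _.
    exists (fun o => if o is Some x then (f x).+1 else 0).
    by move=> [x|] [y|] // [/finj ->].
  apply: card_lt_embeds ltK; apply: embeds_trans H _; exact: embeds_nat_option.
exact: card_lt_embeds ltnat.
Qed.

(** * Formulas *)

Lemma inP (T : eqType) (x : T) (l : seq T) : List.In x l <-> x \in l.
Proof.
elim: l => //= y l IH; rewrite in_cons; split.
  by move=> [->|/IH ->]; rewrite ?eqxx ?orbT.
by move=> /orP[/eqP->|/IH]; [left|right].
Qed.

Section Syntax.
Variable L : language.

Fixpoint term_rename (V W : Type) (h : V -> W) (t : term L V) : term L W :=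
  match t with
  | Var v => Var L (h v)
  | @App _ _ f ts => @App L W f (fun k => term_rename h (ts k))
  end.

Fixpoint rename (V W : Type) (h : V -> W) (phi : formula L V) : formula L W :=
  match phi with
  | Eq t1 t2 => Eq (term_rename h t1) (term_rename h t2)
  | @Rel _ _ r ts => @Rel L W r (fun k => term_rename h (ts k))
  | Not psi => Not (rename h psi)
  | And psi1 psi2 => And (rename h psi1) (rename h psi2)
  | Ex psi => Ex (rename (omap h) psi)
  end.

Fixpoint term_vars (V : Type) (t : term L V) : seq V :=
  match t with
  | Var v => [:: v]
  | @App _ _ f ts => flatten [seq term_vars (ts k) | k <- enum 'I_(farity f)]
  end.

Fixpoint vars (V : Type) (phi : formula L V) : seq V :=
  match phi with
  | Eq t1 t2 => term_vars t1 ++ term_vars t2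
  | @Rel _ _ r ts => flatten [seq term_vars (ts k) | k <- enum 'I_(rarity r)]
  | Not psi => vars psi
  | And psi1 psi2 => vars psi1 ++ vars psi2
  | Ex psi => pmap id (vars psi)
  end.

(** A valid formula without free variables, hence available also when [V] is empty. *)
Definition Tr (V : Type) : formula L V := Ex (Eq (Var L None) (Var L None)).

Definition Iff (V : Type) (phi psi : formula L V) : formula L V :=
  And (Not (And phi (Not psi))) (Not (And psi (Not phi))).

Variable M : structure L.

Lemma eval_rename (V W : Type) (h : V -> W) (e : W -> M) (t : term L V) :
  eval e (term_rename h t) = eval (e \o h) t.
Proof. by elim: t => //= f ts IH; congr fint; apply/funext => k; exact: IH. Qed.

Lemma sat_rename (V W : Type) (h : V -> W) (e : W -> M) (phi : formula L V) :
  sat (rename h phi) e = sat phi (e \o h).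
Proof.
elim: phi W h e => {V} /=.
- by move=> V t1 t2 W h e; rewrite !eval_rename.
- move=> V r ts W h e; congr rint; apply/funext => k; exact: eval_rename.
- by move=> V phi IH W h e; rewrite IH.
- by move=> V phi IH psi IH' W h e; rewrite IH IH'.
- move=> V phi IH W h e; congr ex; apply/funext => m; rewrite IH; congr sat.
  by apply/funext; case.
Qed.

Lemma In_flatten_enum (V : Type) n (F : 'I_n -> seq V) (k : 'I_n) (v : V) :
  List.In v (F k) -> List.In v (flatten [seq F k | k <- enum 'I_n]).
Proof.
have : k \in enum 'I_n by rewrite mem_enum.
elim: (enum _) => //= k' l IH; rewrite in_cons => /orP[/eqP <-|kl] vk.
  by apply: List.in_or_app; left.
by apply: List.in_or_app; right; exact: IH.
Qed.

Lemma eval_vars (V : Type) (e e' : V -> M) (t : term L V) :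
  (forall v, List.In v (term_vars t) -> e v = e' v) -> eval e t = eval e' t.
Proof.
elim: t => /= [v|f ts IH] H; first by apply: H; left.
congr fint; apply/funext => k; apply: IH => v vk; apply: H.
exact: In_flatten_enum vk.
Qed.

Lemma In_pmap_id (V : Type) (v : V) (l : seq (option V)) :
  List.In (Some v) l -> List.In v (pmap id l).
Proof.
by elim: l => //= -[w|] l IH [] //=; [case; left|move=> /IH; right].
Qed.

Lemma sat_vars (V : Type) (e e' : V -> M) (phi : formula L V) :
  (forall v, List.In v (vars phi) -> e v = e' v) -> sat phi e = sat phi e'.
Proof.
elim: phi e e' => {V} /=.
- by move=> V t1 t2 e e' H; rewrite !(@eval_vars V e e') // => v vl;
    apply: H; apply: List.in_or_app; [right|left].
- move=> V r ts e e' H; congr rint; apply/funext => k; apply: eval_vars => v vk.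
  by apply: H; exact: In_flatten_enum vk.
- by move=> V phi IH e e' H; rewrite (IH e e').
- by move=> V phi IH psi IH' e e' H; rewrite (IH e e') ?(IH' e e') // => v vl;
    apply: H; apply: List.in_or_app; [right|left].
- move=> V phi IH e e' H; congr ex; apply/funext => m; apply: IH => -[v|] //= vl.
  by apply: H; exact: In_pmap_id.
Qed.

Lemma sat_Tr (V : Type) (e : V -> M) : sat (Tr V) e.
Proof. by case: (dom_inhabited M) => m; exists m. Qed.

Lemma sat_Iff (V : Type) (phi psi : formula L V) (e : V -> M) :
  sat (Iff phi psi) e <-> (sat phi e <-> sat psi e).
Proof.
rewrite /=; split=> [[H1 H2]|[H1 H2]].
  by split=> H; apply: contrapT => N; [apply: H1|apply: H2].
by split=> -[H]; apply; [exact: H1|exact: H2].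
Qed.

Lemma sat_form_if (V : Type) (phi : formula L V) (c : bool) (e : V -> M) :
  sat (form_if phi c) e <-> (sat phi e <-> c).
Proof.
case: c => /=; first by split=> [?|H]; [split|exact/H].
by split=> [N|H]; [split|move/H].
Qed.

Definition conj_all (V : Type) (l : seq (formula L V)) : formula L V :=
  foldr (@And L V) (Tr V) l.

Lemma sat_conj_all (V : Type) (l : seq (formula L V)) (e : V -> M) :
  sat (conj_all l) e <-> forall phi, List.In phi l -> sat phi e.
Proof.
elim: l => /= [|phi l IH]; first by split=> // _; apply: (sat_Tr e).
split=> [[H /IH Hl] psi [<-|/Hl]|H] //.
by split; [apply: H; left|apply/IH => psi pl; apply: H; right].
Qed.

Definition params_in (A B : Type) (l : seq (A + B)) : seq B :=
  pmap (fun v => if v is inr b then Some b else None) l.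

Lemma In_params_in (A B : Type) (b : B) (l : seq (A + B)) :
  List.In (inr b) l -> List.In b (params_in l).
Proof.
elim: l => //= -[a|b0] l IH [] //=; first by move=> [->]; left.
by move=> /IH; right.
Qed.

(* Quantifies, by [Ex], the variables of [l] one at a time, then maps every
   remaining variable of [B] -- on which nothing depends any longer -- to one
   further bound variable. *)
Lemma exists_block (A B : Type) (phi : formula L (A + B)) :
  exists psi : formula L A, forall e : A -> M,
    sat psi e <-> exists e' : B -> M, sat phi (env_join e e').
Proof.
suff [psi psiE] : exists psi : formula L (A + B), forall e m,
    sat psi (env_join e (fun=> m)) <-> exists e' : B -> M, sat phi (env_join e e').
  exists (Ex (rename (fun v => if v is inl a then Some a else None) psi)) => e /=.
  have E m : env_cons m e \o (fun v : A + B => if v is inl a then Some a else None)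
      = env_join e (fun=> m) by apply/funext; case.
  split=> [[m]|H]; first by rewrite sat_rename E => /psiE.
  by case: (dom_inhabited M) => m; exists m; rewrite sat_rename E; apply/psiE.
pose l : seq {classic B} := params_in (vars phi).
have [psi psiE] : exists psi : formula L (A + B), forall e (e' : B -> M),
    sat psi (env_join e e') <->
    exists2 e'' : B -> M, forall b : {classic B}, b \notin l -> e'' b = e' b
      & sat phi (env_join e e'').
  elim: l => [|b0 l [psi psiE]].
    exists phi => e e'; split=> [H|[e'' H]]; first by exists e'.
    by suff -> : e'' = e' by []; apply/funext => b; exact: H.
  exists (Ex (rename (fun v : A + {classic B} => match v with
    | inl a => Some (inl a) | inr b => if b == b0 then None else Some (inr b) end)
    psi)) => e e' /=.
  have E m : env_cons m (env_join e e') \o (fun v : A + {classic B} => match v with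
      | inl a => Some (inl a) | inr b => if b == b0 then None else Some (inr b) end)
      = env_join e (fun b : {classic B} => if b == b0 then m else e' b).
    by apply/funext => -[a|b] //=; case: eqP.
  split=> [[m]|[e'' He'' H]].
    rewrite sat_rename E => /psiE [e'' He'' H]; exists e'' => // b.
    by rewrite in_cons negb_or => /andP[/negbTE bb0 /He'' ->]; rewrite bb0.
  exists (e'' b0); rewrite sat_rename E; apply/psiE; exists e'' => // b bl.
  by case: eqP => [->//|/eqP bb0]; apply: He''; rewrite in_cons negb_or bb0.
exists psi => e m; split=> [/psiE [e'' _ H]|[e' H]]; first by exists e''.
apply/psiE; exists (fun b : {classic B} => if b \in l then e' b else m).
  by move=> b /negbTE ->.
rewrite -(@sat_vars _ (env_join e e')) // => -[a|b] //= bl.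
by rewrite (proj1 (@inP {classic B} b l) (In_params_in bl)).
Qed.

(** Only finitely many parameter variables occur in a formula, so an infinite tuple of parameters
    can be cut down to a finite one. *)
Lemma finite_params (X W : Type) (phi : formula L (X + W)) : W ->
  exists (n : nat) (psi : formula L (X + 'I_n)) (g : 'I_n -> W),
  forall (x : X -> M) (e : W -> M),
    sat psi (env_join x (e \o g)) = sat phi (env_join x e).
Proof.
move=> w0.
(* The head [w0] makes the length of the list a successor, as [inord] requires, and serves as the
   default of [nth]. *)
pose l : seq {classic W} :=
  w0 :: params_in (vars phi).
exists (size l), (rename (fun v : X + {classic W} => match v with
  | inl x => inl x | inr w => inr (inord (index w l)) end) phi).
exists (fun k => nth w0 l k) => x e; rewrite sat_rename; apply: sat_vars.
move=> [x'|w] //= wl.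
have {}wl := proj1 (@inP {classic W} w _) (In_params_in wl).
have wl' : (w : {classic W}) \in l by rewrite in_cons wl orbT.
have wlt : index (w : {classic W}) l < size l by rewrite index_mem.
rewrite -[in RHS](nth_index (w0 : {classic W}) wl'); congr (e (nth w0 l _)); exact: inordK.
Qed.

End Syntax.

(** * Compactness in a saturated structure *)

Lemma finite_set_list (T : Type) (F : set T) : finite_set F ->
  exists s : seq T, forall x, F x <-> List.In x s.
Proof.
move=> /(@finite_seqP {classic T})[s ->]; exists s => x /=.
by split=> /(@inP {classic T}).
Qed.

(** Saturation realizes types in finitely many variables; Zorn's lemma extends this to a small
    family [V] of variables. A maximal partial assignment that keeps [S] finitely satisfiable is
    total: the remaining requirements on one more variable [v0], the other unassigned ones being
    quantified away, form a type over few parameters. *)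
Lemma saturated_compact (L : language) (M : structure L) (Kbar : Type)
    (Msat : saturated M Kbar) (A V : Type)
    (small : [set: (A + V)%type] #< [set: Kbar]) (a : A -> M)
    (S : set (formula L (A + V))) :
  (forall l : seq (formula L (A + V)), (forall phi, List.In phi l -> S phi) ->
    exists v : V -> M, forall phi, List.In phi l -> sat phi (env_join a v)) ->
  exists v : V -> M, forall phi, S phi -> sat phi (env_join a v).
Proof.
move=> finsat.
pose P (G : set (V * M)) := forall l, (forall phi, List.In phi l -> S phi) ->
  exists2 v : V -> M, forall x m, G (x, m) -> v x = m &
    forall phi, List.In phi l -> sat phi (env_join a v).
have P0 : P set0 by move=> l /finsat[v vl]; exists v.
have Pfun G x m m' : P G -> G (x, m) -> G (x, m') -> m = m'.
  move=> /(_ [::]) [//|v vG _] Gm Gm'; rewrite -(vG _ _ Gm); exact: vG.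
have [F FP Ftot|G [GP Gmax]] := @Zorn_bigcup _ P.
  set U := \bigcup_(X in F) X => l lS.
  have Ufun x m m' : U (x, m) -> U (x, m') -> m = m'.
    move=> [X FX Xm] [Y FY Ym']; have [XY|YX] := Ftot _ _ FX FY.
      exact: Pfun (FP _ FY) (XY _ Xm) Ym'.
    exact: Pfun (FP _ FX) Xm (YX _ Ym').
  (* Finitely many variables occur in [l], so one member of the chain already assigns all those that
     the union assigns. *)
  have [X [XF XU]] : exists X, (X = set0 \/ F X) /\
      forall x m, List.In (inr x) (vars (conj_all l)) -> U (x, m) -> X (x, m).
    elim: (vars _) => [|[y|y] xs [X [XF XU]]]; first by exists set0; split; [left|].
      by exists X; split=> // x m [//|]; exact: XU.
    have [[m [Y FY Ym]]|N] := pselect (exists m, U (y, m)); last first.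
      by exists X; split=> // x m [[yx] Um|]; [by case: N; exists m; rewrite yx|exact: XU].
    case: XF => [X0|FX].
      exists Y; split; first by right.
      move=> x m' [[yx] Um'|xl Um']; last by have := XU _ _ xl Um'; rewrite X0.
      by rewrite -yx in Um' *; rewrite (Ufun _ _ _ Um' (ex_intro2 _ _ Y FY Ym)).
    have [XY|YX] := Ftot _ _ FX FY.
      exists Y; split; first by right.
      move=> x m' [[yx] Um'|xl Um']; last by apply: XY; exact: XU.
      by rewrite -yx in Um' *; rewrite (Ufun _ _ _ Um' (ex_intro2 _ _ Y FY Ym)).
    exists X; split; first by right.
    move=> x m' [[yx] Um'|xl Um']; last exact: XU.
    by rewrite -yx in Um' *; rewrite (Ufun _ _ _ Um' (ex_intro2 _ _ Y FY Ym)); exact: YX.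
  have XP : P X by case: XF => [->|/FP].
  have [v vX vl] := XP l lS.
  (* [w] follows the union of the chain where it is defined and [v] elsewhere; on the variables of
     [l] it coincides with [v]. *)
  have /choice[w wP] x : exists m, if `[< exists m, U (x, m) >] then U (x, m)
      else m = v x.
    by case: asboolP => [//|_]; exists (v x).
  exists w => [x m Um|].
    by have := wP x; case: asboolP => [_ /Ufun|N _]; [exact|case: N; exists m].
  apply/sat_conj_all; rewrite -(@sat_vars _ _ _ (env_join a v)); first exact/sat_conj_all.
  move=> [x|x] //= xl; have := wP x; case: asboolP => [_ Uw|_ -> //].
  by apply: vX; exact: XU.
have [dom|/existsNP[v0 /forallNP Nv0]] := pselect (forall x, exists m, G (x, m)).
  have [v vG] := choice dom; exists v => phi Sphi.
  have [|w wG ws] := GP [:: phi]; first by move=> _ [<-|[]].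
  have -> : v = w by apply/funext => x; rewrite (wG _ _ (vG x)).
  by apply: ws; left.
exfalso; have [m0] := dom_inhabited M.
have /choice[ev evP] x : exists m, if `[< exists m, G (x, m) >] then G (x, m)
    else m = m0.
  by case: asboolP => [//|_]; exists m0.
pose e := env_join a ev.
pose fill (x : 'I_1 -> M) (v' : V -> M) (v : {classic V}) : M :=
  if v == v0 then x ord0 else if `[< exists m, G (v, m) >] then ev v else v' v.
(* [Q l p]: the one-variable formula [p], with parameters among the values of [e], says that giving
   [v0] the value [x] leaves [l] satisfiable together with the partial assignment. *)
pose Q l (p : pformula M 'I_1) := (forall k, range e (@par L M _ p k)) /\
  forall x : 'I_1 -> M, psat p x <-> exists v', sat (conj_all l) (env_join a (fill x v')).
have exQ l : exists p, Q l p.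
  pose rho (v : A + {classic V}) : ('I_1 + (A + V)) + V := match v with
    | inl b => inl (inr (inl b))
    | inr v => if v == v0 then inl (inl ord0)
      else if `[< exists m, G (v, m) >] then inl (inr (inr v)) else inr v
    end.
  have [psi psiE] := exists_block M (rename rho (conj_all l)).
  have [n [chi [g chiE]]] := finite_params M psi (inr v0).
  exists (PFormula chi (e \o g)); split=> [k|x]; first by exists (g k).
  have E v' : env_join (env_join x e) v' \o rho = env_join a (fill x v').
    apply/funext => -[b|v] //=; rewrite /fill.
    by case: ifP => // _; case: asboolP.
  rewrite /psat /= chiE psiE; split=> -[v' H]; exists v'; first by rewrite -E -sat_rename.
  by rewrite sat_rename E.
have [x xS] : realized [set p | exists2 l, (forall phi, List.In phi l -> S phi) & Q l p].
  apply: (Msat (range e)).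
  - split; first by case: small => + _; exact/card_le_trans/card_image_le.
    case: small => _ N /card_le_trans /(_ (card_image_le e setT)); exact: N.
  - by move=> p [l _ [H _]] k; exact: H.
  move=> Fin FinS /finite_set_list[s sE].
  (* The finitely many lists behind [Fin] are concatenated, so that a single solution serves all of
     them. *)
  have [l lS lQ] : exists2 l, forall phi, List.In phi l -> S phi &
      forall p, List.In p s -> exists2 l', List.incl l' l & Q l' p.
    have : forall p, List.In p s -> Fin p by move=> p /sE.
    elim: s {sE} => [|p s IH] sF; first by exists [::].
    have [l lS lQ] := IH (fun p ps => sF p (or_intror ps)).
    have [l' l'S l'Q] := FinS p (sF p (or_introl erefl)).
    exists (l ++ l').
      by move=> phi pl; case: (List.in_app_or _ _ _ pl); [exact: lS|exact: l'S].
    move=> q [<-|qs].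
      by exists l' => // phi ?; apply: List.in_or_app; right.
    have [l2 l2l Ql2] := lQ _ qs.
    by exists l2 => // phi ?; apply: List.in_or_app; left; exact: l2l.
  have [v vG vl] := GP l lS.
  exists (fun=> v v0) => p /sE /lQ[l' l'l [_ Qp]]; apply/Qp; exists v.
  apply/sat_conj_all => phi /l'l /vl; congr sat; congr env_join; apply/funext => y.
  rewrite /fill; case: eqP => [->//|_]; have := evP y; case: asboolP => // _.
  exact: vG.
apply: (Gmax (G `|` [set (v0, x ord0)])).
  split; first by left.
  by move=> /(_ (v0, x ord0) (or_intror erefl)); exact: Nv0.
move=> l lS; have [p Qp] := exQ l; have [|v' /sat_conj_all v'l] := (proj2 Qp x).1.
  by apply: xS; exists l.
exists (fill x v') => // y m [Gym|[-> ->]]; rewrite /fill; last by rewrite eqxx.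
case: eqP => [yv0|_]; first by case: (Nv0 m); rewrite -yv0.
have := evP y; case: asboolP => [_ H|[]]; last by exists m.
exact: Pfun GP H Gym.
Qed.

(** * Iterated ultrafilter quantifiers *)

Section IteratedQuantifier.
Variables (V : eqType) (D : Type) (U : V -> set_system D).
Hypothesis Uultra : forall v, UltraFilter (U v).
#[local] Existing Instance Uultra.

Definition upd (j : V -> D) (v : V) (x : D) (w : V) : D :=
  if w == v then x else j w.

(** The iterated product of ultrafilters: for almost all values of the first variable of [l], for
    almost all values of the second, and so on, [R] holds. The variables outside [l] keep their
    values in [j]. *)
Fixpoint qiter (l : seq V) (R : (V -> D) -> Prop) (j : V -> D) : Prop :=
  if l is v :: l' then U v [set x | qiter l' R (upd j v x)] else R j.

Lemma qiter_imp l (R R' : (V -> D) -> Prop) j : (forall j, R j -> R' j) ->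
  qiter l R j -> qiter l R' j.
Proof.
move=> RR'; elim: l j => [|v l IH] j /=; first exact: RR'.
by apply: filterS => x; exact: IH.
Qed.

Lemma qiter_and l (R R' : (V -> D) -> Prop) j :
  qiter l R j -> qiter l R' j -> qiter l (fun j => R j /\ R' j) j.
Proof.
elim: l j => [|v l IH] j //= H H'.
by apply: filterS (filterI H H') => x []; exact: IH.
Qed.

(** An ultrafilter contains exactly one of a set and its complement; so generic truth behaves like
    truth with respect to the connectives. *)
Lemma qiter_not l (R : (V -> D) -> Prop) j :
  qiter l (fun j => ~ R j) j <-> ~ qiter l R j.
Proof.
elim: l j => [|v l IH] j //=.
have -> : [set x | qiter l (fun j => ~ R j) (upd j v x)] =
    ~` [set x | qiter l R (upd j v x)].
  by apply/seteqP; split=> x /=; rewrite IH.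
split=> [H H'|N]; first by have [x []] := filter_ex (filterI H H').
by case: (in_ultra_setVsetC [set x | qiter l R (upd j v x)] (Uultra v)).
Qed.

Lemma qiter_true l (R : (V -> D) -> Prop) j : (forall j, R j) -> qiter l R j.
Proof.
move=> HR; elim: l j => [|v l IH] j //=.
by apply: filterS filterT => x _; exact: IH.
Qed.

Lemma qiter_iff l (R R' : (V -> D) -> Prop) j :
  (qiter l R j <-> qiter l R' j) -> qiter l (fun j => R j <-> R' j) j.
Proof.
move=> H; have [HR|NR] := pselect (qiter l R j).
  by apply: qiter_imp (qiter_and HR (H.1 HR)) => j' [].
have NR' : ~ qiter l R' j by move/H.
by apply: qiter_imp (qiter_and ((qiter_not _ _ _).2 NR) ((qiter_not _ _ _).2 NR')) => j' [].
Qed.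

Lemma qiter_all (T : Type) (s : seq T) l (R : T -> (V -> D) -> Prop) j :
  (forall x, List.In x s -> qiter l (R x) j) ->
  qiter l (fun j => forall x, List.In x s -> R x j) j.
Proof.
elim: s => [|x s IH] H; first exact: qiter_true.
have Hx := H x (or_introl erefl).
apply: qiter_imp (qiter_and Hx (IH (fun y ys => H y (or_intror ys)))).
by move=> j' [H1 H2] y [<-|/H2].
Qed.

Lemma qiter_ex l (R : (V -> D) -> Prop) j : qiter l R j -> exists j', R j'.
Proof.
elim: l j => [|v l IH] j /=; first by exists j.
by move=> /filter_ex[x]; exact: IH.
Qed.

End IteratedQuantifier.

(* Quantified variables on which the predicate does not depend can be dropped. *)
Lemma qiter_subseq (V W : eqType) (D : Type) (U : V -> set_system D)
    (U' : W -> set_system D) (f : W -> V) (l : seq V) (l' : seq W)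
    (R : (W -> D) -> Prop) (j : V -> D) (j' : W -> D) :
  (forall v, UltraFilter (U v)) -> (forall w, U' w = U (f w)) ->
  uniq l -> subseq (map f l') l ->
  (forall j1 j2, {in l', j1 =1 j2} -> R j1 -> R j2) ->
  qiter U l (fun j => R (j \o f)) j <-> qiter U' l' R j'.
Proof.
move=> UU U'E lU sub RE.
(* For the induction: [R] depends on [S] only, and the variables of [S] outside [l'] have equal
   values on both sides and are not quantified again. *)
suff gen (S : set W) : (forall j1 j2, (forall w, S w -> j1 w = j2 w) -> R j1 -> R j2) ->
    (forall w, S w -> w \notin l' -> j (f w) = j' w /\ f w \notin l) ->
    qiter U l (fun j => R (j \o f)) j <-> qiter U' l' R j'.
  by apply: (gen [set w | w \in l']) => [|w /= ->] // j1 j2; exact: RE.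
move=> {}RE; elim: l l' lU sub j j' => [|v l IH] l' lU sub j j' SE.
  by case: l' sub SE => //= _ SE; split; apply: RE => w /SE[].
have [vl lU'] := andP lU; case: l' sub SE => [|w l'] /= sub SE.
  have -> : [set x | qiter U l (fun j => R (j \o f)) (upd j v x)] = [set _ | R j'].
    have H x w : S w -> w \notin [::] -> upd j v x (f w) = j' w /\ f w \notin l.
      by move=> Sw /(SE w Sw)[E]; rewrite inE negb_or /upd => /andP[/negbTE->].
    by apply/seteqP; split=> x ?; apply/(IH [::] lU' (sub0seq _) _ j' (H x)).
  by split=> [/filter_ex[]//|Rj']; apply: filterS filterT.
case: eqP sub => [fwv|fwv] sub.
  rewrite U'E fwv.
  suff -> : [set x | qiter U l (fun j => R (j \o f)) (upd j v x)] =
      [set x | qiter U' l' R (upd j' w x)] by [].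
  have H x w' : S w' -> w' \notin l' ->
      upd j v x (f w') = upd j' w x w' /\ f w' \notin l.
    move=> Sw' w'l'; rewrite /upd; case: (eqVneq w' w) => [->|w'w].
      by rewrite fwv eqxx.
    have [|E] := SE w' Sw'; first by rewrite inE negb_or w'w.
    by rewrite inE negb_or => /andP[/negbTE->].
  by apply/seteqP; split=> x ?; apply/(IH l' lU' sub _ _ (H x)).
have -> : [set x | qiter U l (fun j => R (j \o f)) (upd j v x)] =
    [set _ | qiter U' (w :: l') R j'].
  have H x w' : S w' -> w' \notin w :: l' -> upd j v x (f w') = j' w' /\ f w' \notin l.
    by move=> Sw' /(SE w' Sw')[E]; rewrite inE negb_or /upd => /andP[/negbTE->].
  by apply/seteqP; split=> x ?; apply/(IH (w :: l') lU' sub _ j' (H x)).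
by split=> [/filter_ex[]//|Rj']; apply: filterS filterT.
Qed.

Lemma qiter_sublist (V : eqType) (D : Type) (U : V -> set_system D) (l l' : seq V)
    (R : (V -> D) -> Prop) (j : V -> D) :
  (forall v, UltraFilter (U v)) -> uniq l -> subseq l' l ->
  (forall j1 j2, {in l', j1 =1 j2} -> R j1 -> R j2) ->
  qiter U l' R j -> qiter U l R j.
Proof.
move=> UU lU sub RE; have H := @qiter_subseq V V D U U id l l' R j j UU.
by apply: (proj2 (H _ lU _ RE)); rewrite ?map_id.
Qed.

(** * Mutually indiscernible arrays *)

(** The variable [(i, w, k)] stands for coordinate [k] of the entry labelled [w] in row [i], and [f]
    tells at which index of the row this entry sits. The entries are sequences indexed by [nat]. *)
Definition sel (D K P W : Type) (J : K -> P -> nat -> D) (f : K -> W -> P)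
    (v : K * W * nat) : D :=
  J v.1.1 (f v.1.1 v.1.2) v.2.

Definition selV (A K W P : Type) (f : K -> W -> P)
    (v : A + K * W * nat) : A + K * P * nat :=
  match v with inl a => inl a | inr w => inr (w.1.1, f w.1.1 w.1.2, w.2) end.

Definition increasing (K : Type) (f : K -> nat -> rat) : Prop :=
  forall i n n', n < n' -> (f i n < f i n')%R.

Lemma array_support (L : language) (M : structure L) (A : Type) (K W : eqType)
    (phi : formula L (A + K * W * nat)) :
  exists (lK : seq K) (lW : seq W), forall (a : A -> M) (s s' : K * W * nat -> M),
    (forall i w k, i \in lK -> w \in lW -> s (i, w, k) = s' (i, w, k)) ->
    sat phi (env_join a s) = sat phi (env_join a s').
Proof.
exists [seq v.1.1 | v <- params_in (vars phi)], [seq v.1.2 | v <- params_in (vars phi)].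
move=> a s s' ss'; apply: sat_vars => -[//|[[i w] k]] vl /=.
have H := proj1 (inP _ _) (In_params_in vl).
by apply: ss'; [apply: (map_f (fun v => v.1.1)) H|apply: (map_f (fun v => v.1.2)) H].
Qed.

Lemma array_support_nat (L : language) (M : structure L) (A : Type) (K : eqType)
    (phi : formula L (A + K * nat * nat)) :
  exists (lK : seq K) (m : nat), forall (a : A -> M) (s s' : K * nat * nat -> M),
    (forall i n k, i \in lK -> n < m -> s (i, n, k) = s' (i, n, k)) ->
    sat phi (env_join a s) = sat phi (env_join a s').
Proof.
have [lK [lW H]] := array_support M phi; exists lK, (\max_(n <- lW) n).+1.
by move=> a s s' ss'; apply: H => i w k il wl; apply: ss' => //; rewrite ltnS leq_bigmax_seq.
Qed.

Lemma subseq_allpairs (I P : eqType) (s s' : seq I) (t : I -> seq P) (t' : seq P) :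
  subseq s s' -> {in s, forall i, subseq (t i) t'} ->
  subseq [seq (i, p) | i <- s, p <- t i] [seq (i, p) | i <- s', p <- t'].
Proof.
elim: s' s => [|i' s' IH] [|i s] //=; first by move=> _ _; exact: sub0seq.
case: eqP => [<-|_] ss' tt'; last first.
  by apply: subseq_trans (IH (i :: s) ss' tt') _; exact: suffix_subseq.
apply: cat_subseq; first by apply: map_subseq; apply: tt'; rewrite mem_head.
by apply: IH => // k ks; apply: tt'; rewrite in_cons ks orbT.
Qed.

Lemma subseq_sorted_sub d (P : orderType d) (s t : seq P) :
  sorted <%O s -> sorted <%O t -> {subset s <= t} -> subseq s t.
Proof.
move=> ss st sub.
have -> : s = [seq x <- t | x \in s].
  apply: (irr_sorted_eq lt_trans ltxx ss) => [|x]; first exact: sorted_filter lt_trans _ _ st.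
  by rewrite mem_filter; case: (boolP (x \in s)) => //= /sub ->.
exact: filter_subseq.
Qed.

Section IndiscernibleArray.
Variables (L : language) (M : structure L) (Kbar : Type).
Hypothesis Msat : saturated M Kbar.
Variables (A : Type) (K : eqType).
Hypothesis small : [set: (A + K * rat * nat)%type] #< [set: Kbar].
Variables (D : Type) (d0 : D) (ltD : D -> D -> Prop).
Variables (labD : D -> bool) (lab : rat -> bool).
Variable U : bool -> set_system D.
Hypothesis Uultra : forall c, UltraFilter (U c).
Hypothesis Ulab : forall p, U (lab p) [set y | labD y = lab p].
Hypothesis Ult : forall p p' x, (p < p')%R -> labD x = lab p ->
  U (lab p') [set y | ltD x y].
Variables (b : K -> D -> nat -> M) (a : A -> M).

#[local] Existing Instance Uultra.

Let UV (v : K * rat) := U (lab v.2).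
#[local] Instance UVultra (v : K * rat) : UltraFilter (UV v) := Uultra _.
Let grid (lK : seq K) (lP : seq rat) := [seq (i, p) | i <- lK, p <- lP].

(* Truth of [phi] at generic indices.  The rows are quantified in the order of
   [lK'], on which this truth may depend: no order of [K] is fixed. *)
Let generic (phi : formula L (A + K * rat * nat)) : Prop :=
  exists (lK : seq K) (lP : seq rat), forall lK' lP', uniq lK' -> sorted <%R lP' ->
    {subset lK <= lK'} -> {subset lP <= lP'} ->
    qiter UV (grid lK' lP')
      (fun j => sat phi (env_join a (sel b (fun i p => j (i, p))))) (fun=> d0).

Let uniq_grid lK lP : uniq lK -> sorted <%R lP -> uniq (grid lK lP).
Proof.
by move=> uK sP; apply: allpairs_uniq => //; [exact: lt_sorted_uniq|move=> [? ?] [? ?]].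
Qed.

(** Finitely many generic formulas share one grid, on which they hold generically together, hence at
    some actual indices. *)
Let generic_sat (l : seq (formula L (A + K * rat * nat))) :
  (forall phi, List.In phi l -> generic phi) ->
  exists v, forall phi, List.In phi l -> sat phi (env_join a v).
Proof.
move=> gen.
have [lK [lP H]] : exists (lK : seq K) (lP : seq rat), forall lK' lP',
    uniq lK' -> sorted <%R lP' ->
    {subset lK <= lK'} -> {subset lP <= lP'} -> forall phi, List.In phi l ->
    qiter UV (grid lK' lP')
      (fun j => sat phi (env_join a (sel b (fun i p => j (i, p))))) (fun=> d0).
  elim: l gen => [|phi l IH] gen; first by exists [::], [::].
  have [lK [lP H]] := IH (fun phi pl => gen phi (or_intror pl)).
  have [lK1 [lP1 H1]] := gen phi (or_introl erefl).
  exists (lK ++ lK1), (lP ++ lP1) => lK' lP' uK sP subK subP psi [<-|psil].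
    by apply: H1 => // x xl; [apply: subK|apply: subP]; rewrite mem_cat xl orbT.
  by apply: H => // x xl; [apply: subK|apply: subP]; rewrite mem_cat xl.
have sP : sorted <%R (sort <=%R (undup lP)) by rewrite sort_lt_sorted undup_uniq.
have subK : {subset lK <= undup lK} by move=> x; rewrite mem_undup.
have subP : {subset lP <= sort <=%R (undup lP)} by move=> x; rewrite mem_sort mem_undup.
have [j jl] := qiter_ex UVultra (qiter_all UVultra (H _ _ (undup_uniq _) sP subK subP)).
by exists (sel b (fun i p => j (i, p))).
Qed.

(** After the selection by [f], the only trace of [f] is in the ultrafilters [U (lab (f i n))]: as
    [f i] is increasing, the order of quantification within a row is that of the labels [n]. *)
Let generic_selV (phi : formula L (A + K * nat * nat)) :
  exists (lK : seq K) (m : nat), forall f (lK' : seq K) (lP' : seq rat),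
    increasing f -> uniq lK' -> sorted <%R lP' ->
    {subset lK <= lK'} -> (forall i n, i \in lK -> n < m -> f i n \in lP') ->
    qiter UV (grid lK' lP')
      (fun j => sat (rename (selV f) phi) (env_join a (sel b (fun i p => j (i, p))))) (fun=> d0)
    <-> qiter (fun v => U (lab (f v.1 v.2)))
      [seq (i, n) | i <- [seq i <- lK' | i \in lK], n <- iota 0 m]
      (fun j => sat phi (env_join a (sel b (fun i n => j (i, n))))) (fun=> d0).
Proof.
have [lK [m supp]] := array_support_nat M phi; exists lK, m.
move=> f lK' lP' finc uK sP subK subP.
have E (j : K * rat -> D) : sat (rename (selV f) phi)
      (env_join a (sel b (fun i p => j (i, p)))) =
    sat phi (env_join a (sel b (fun i n => (j \o (fun v => (v.1, f v.1 v.2))) (i, n)))).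
  by rewrite sat_rename; congr sat; apply/funext => -[].
under [X in qiter _ _ X _]funext => j do rewrite E.
apply: (qiter_subseq (R := fun j => sat phi (env_join a (sel b (fun i n => j (i, n)))))) => //.
- exact: uniq_grid.
- have -> : [seq (v.1, f v.1 v.2) | v <-
      [seq (i, n) | i <- [seq i <- lK' | i \in lK], n <- iota 0 m]] =
      [seq (i, p) | i <- [seq i <- lK' | i \in lK], p <- [seq f i n | n <- iota 0 m]].
    by rewrite map_allpairs allpairs_mapr.
  apply: subseq_allpairs; first by apply: filter_subseq.
  move=> i;   rewrite mem_filter => /andP[il _]; apply: subseq_sorted_sub => //.
    exact: homo_sorted (finc i) _ (iota_ltn_sorted _ _).
  by move=> p /mapP[n]; rewrite mem_iota => nm ->; exact: subP.
move=> j1 j2 j12; rewrite (supp _ _ (sel b (fun i n => j2 (i, n)))) // => i n k il nm.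
rewrite /sel /= j12 //; apply/allpairsP; exists (i, n); rewrite mem_iota.
by rewrite mem_filter il /=; split=> //; exact: subK.
Qed.

(** Saturation realizes all generic formulas at once. Generic truth depends on a selection through
    the labels of its indices only, which gives the first clause; generic indices increase along
    each row and carry the right labels, which gives the second. *)
Lemma indiscernible_array : exists J : K -> rat -> nat -> M,
  (forall phi f g, increasing f -> increasing g ->
    (forall i n, lab (f i n) = lab (g i n)) ->
    sat phi (env_join a (sel J f)) <-> sat phi (env_join a (sel J g))) /\
  (forall phi f (lK : seq K) m, increasing f ->
    (forall j : K -> nat -> D,
      (forall i n n', i \in lK -> n < n' -> n' < m -> ltD (j i n) (j i n')) ->
      (forall i n, i \in lK -> n < m -> labD (j i n) = lab (f i n)) ->
      sat phi (env_join a (sel b j))) ->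
    sat phi (env_join a (sel J f))).
Proof.
have [v vP] := saturated_compact Msat small generic_sat.
exists (fun i p k => v (i, p, k)).
have selE f : env_join a v \o selV f = env_join a (sel (fun i p k => v (i, p, k)) f).
  by apply/funext => -[].
split=> [phi f g finc ginc fg|phi f lK m finc H].
  have [lK [m H]] := generic_selV phi.
  have /vP : generic (Iff (rename (selV f) phi) (rename (selV g) phi)).
    exists lK, ([seq f i n | i <- lK, n <- iota 0 m] ++ [seq g i n | i <- lK, n <- iota 0 m]).
    move=> lK' lP' uK sP subK subP.
    under [X in qiter _ _ X _]funext => j do rewrite (propext (sat_Iff _ _ _)).
    apply: qiter_iff.
    have subfg h : {subset [seq h i n | i <- lK, n <- iota 0 m] <= lP'} ->
        forall i n, i \in lK -> n < m -> h i n \in lP'.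
      by move=> hP i n il nm; apply/hP/allpairsP; exists (i, n); rewrite mem_iota.
    have Hf := H f lK' lP' finc uK sP subK (subfg f _).
    have Hg := H g lK' lP' ginc uK sP subK (subfg g _).
    rewrite Hf; last by move=> x xf; apply: subP; rewrite mem_cat xf.
    rewrite Hg; last by move=> x xg; apply: subP; rewrite mem_cat xg orbT.
    suff -> : (fun v : K * nat => U (lab (f v.1 v.2))) =
      (fun v : K * nat => U (lab (g v.1 v.2))) by [].
    by apply/funext => x; rewrite fg.
  by rewrite sat_Iff !sat_rename !selE.
suff /vP : generic (rename (selV f) phi) by rewrite sat_rename selE.
exists lK, [seq f i n | i <- lK, n <- iota 0 m] => lK' lP' uK sP subK subP.
have inP' i n : i \in lK -> n < m -> (i, f i n) \in grid lK' lP'.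
  move=> il nm; apply/allpairsP; exists (i, f i n); split=> //=; first exact: subK.
  by apply: subP; apply/allpairsP; exists (i, n); rewrite mem_iota.
(* One instance of the order and label requirements; the finitely many instances needed hold
   generically together. *)
pose Q (x : K * (nat * nat)) (j : K * rat -> D) :=
  (x.2.1 < x.2.2 -> ltD (j (x.1, f x.1 x.2.1)) (j (x.1, f x.1 x.2.2))) /\
  labD (j (x.1, f x.1 x.2.1)) = lab (f x.1 x.2.1).
have Qgen : forall x, List.In x [seq (i, nn) | i <- lK, nn <-
    [seq (n, n') | n <- iota 0 m, n' <- iota 0 m]] -> qiter UV (grid lK' lP') (Q x) (fun=> d0).
  move=> [i [n n']] xl; have /allpairsP := proj1 (inP _ _) xl.
  move=> [[i0 nn]] /= [il /allpairsP[[n0 n'0]] /=] {xl}.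
  rewrite !mem_iota /= => -[n0m n'0m ->] [-> -> ->] {i n n' nn}.
  apply: qiter_and.
    have [nn'|_] := boolP (n0 < n'0); last exact: qiter_true.
    (* Only two variables matter, the smaller index being quantified first, as [Ult] requires. *)
    apply: (qiter_sublist (l' := [:: (i0, f i0 n0); (i0, f i0 n'0)])) => //.
    - exact: uniq_grid.
    - have -> : [:: (i0, f i0 n0); (i0, f i0 n'0)] =
          [seq (i, p) | i <- [:: i0], p <- [:: f i0 n0; f i0 n'0]] by [].
      apply: subseq_allpairs; first by rewrite sub1seq subK.
      move=> i _; apply: subseq_sorted_sub => //; first by rewrite /= finc.
      by move=> p; rewrite !inE => /orP[]/eqP->; apply: subP; apply/allpairsP;
        [exists (i0, n0)|exists (i0, n'0)]; rewrite mem_iota.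
    - by move=> j1 j2 j12; rewrite !j12 // !inE eqxx ?orbT.
    have fnn' := finc i0 _ _ nn'.
    apply: filterS (Ulab _) => x /= xl; apply: filterS (Ult fnn' xl) => y /=.
    rewrite /upd !eqxx; case: eqP => // -[e]; by rewrite e ltxx in fnn'.
  apply: (qiter_sublist (l' := [:: (i0, f i0 n0)])) => //.
  - exact: uniq_grid.
  - by rewrite /= sub1seq inP'.
  - by move=> j1 j2 ->; rewrite ?mem_head.
  by apply: filterS (Ulab _) => y /=; rewrite /upd eqxx.
apply: (qiter_imp UVultra) (qiter_all UVultra Qgen) => j jQ; rewrite sat_rename.
have -> : env_join a (sel b (fun i p => j (i, p))) \o selV f =
    env_join a (sel b (fun i n => j (i, f i n))) by apply/funext => -[].
have inS i n n' : i \in lK -> n < m -> n' < m -> List.In (i, (n, n'))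
    [seq (i, nn) | i <- lK, nn <- [seq (n, n') | n <- iota 0 m, n' <- iota 0 m]].
  move=> il nm n'm; apply: (proj2 (inP _ _)).
  apply/allpairsP; exists (i, (n, n')); split=> //=.
  by apply/allpairsP; exists (n, n'); rewrite !mem_iota.
apply: H => [i n n' il nn' n'm|i n il nm].
  by case: (jQ (i, (n, n'))) => [|/(_ nn')//]; apply: inS => //; exact: ltn_trans n'm.
by case: (jQ (i, (n, n)) (inS _ _ _ il nm nm)).
Qed.

End IndiscernibleArray.

(** * Cut patterns *)

Lemma ultra_from (D I : Type) (X : set I) (B : I -> set D) :
  (exists x, X x) ->
  (forall x y, X x -> X y -> exists2 z, X z & B z `<=` B x `&` B y) ->
  (forall x, X x -> exists d, B x d) ->
  exists2 U : set_system D, UltraFilter U & forall x, X x -> U (B x).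
Proof.
move=> X0 Bdir B0.
have FF : ProperFilter (filter_from X B).
  apply: filter_from_proper; last exact: B0.
  by apply: filter_from_filter; last exact: Bdir.
have [U [UU sub]] := ultraFilterLemma FF.
by exists U => // x Xx; apply: sub; exists x.
Qed.

Lemma ultra_nat : exists2 U : set_system nat, UltraFilter U &
  forall n, U [set m | n < m].
Proof.
have [||n _|U UU H] := @ultra_from nat nat setT (fun n => [set m | n < m]).
- by exists 0.
- move=> x y _ _; exists (maxn x y) => // z /=.
  by rewrite gtn_max => /andP[].
- by exists n.+1 => /=.
by exists U => // n; exact: H.
Qed.

(* Nonprincipal ultrafilters on the two sides of the cut at [0]: the [false]
   one converges to [0] from the left, the [true] one tends to infinity. *)
Lemma ultra_rat : exists U : bool -> set_system rat,
  [/\ forall c, UltraFilter (U c),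
      forall c, U c [set y | (0 <= y)%R = c] &
      forall (c : bool) (x : rat), ((0 <= x)%R -> c) -> U c [set y | (x < y)%R]].
Proof.
have [||x _|Up UpU Hp] := @ultra_from rat rat setT
    (fun x => [set y | (x < y)%R /\ (0 <= y)%R]).
- by exists 0%R.
- move=> x y _ _; exists (Num.max x y) => // z /= [].
  by rewrite gt_max => /andP[].
- exists (Num.max x 0 + 1)%R => /=; have : (x <= Num.max x 0)%R by rewrite le_max lexx.
  have : (0 <= Num.max x 0)%R by rewrite le_max lexx orbT.
  by lra.
have [||x x0|Un UnU Hn] := @ultra_from rat rat [set x | (x < 0)%R]
    (fun x => [set y | (x < y)%R /\ (y < 0)%R]).
- by exists (-1)%R => /=; lra.
- move=> x y x0 y0; exists (Num.max x y) => [|z /= []] /=.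
    by rewrite gt_max x0.
  by rewrite gt_max => /andP[].
- by exists (x / 2)%R => /=; move: x0 => /=; lra.
exists (fun c => if c then Up else Un); split=> -[] //.
- by apply: filterS (Hp 0%R I) => y /= [].
- apply: filterS (Hn (-1)%R _) => [y /= []|/=]; last by lra.
  by move=> _; rewrite leNgt => ->.
- by move=> x _; apply: filterS (Hp x I) => y /= [].
- move=> x H; apply: filterS (Hn x _) => [y /= []//|/=].
  by rewrite ltNge; apply/negP => /H.
Qed.

(** Makes the existence of a realization of a finite pattern a formula in the parameters, to be
    transferred by indiscernibility. *)
Lemma exists_pattern (L : language) (M : structure L) (X W : Type)
    (F : seq (formula L (X + W) * bool)) :
  exists psi : formula L W, forall e : W -> M,
    sat psi e <-> exists x, forall chi c, List.In (chi, c) F ->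
      (sat chi (env_join x e) <-> c).
Proof.
pose swap (v : X + W) : W + X := match v with inl x => inr x | inr w => inl w end.
have [psi psiE] := exists_block M
  (conj_all [seq rename swap (form_if v.1 v.2) | v <- F]).
have E (e : W -> M) x : env_join e x \o swap = env_join x e by apply/funext => -[].
exists psi => e; rewrite psiE; split=> -[x H]; exists x.
  move=> chi c cF; apply/sat_form_if; rewrite -E -sat_rename.
  by apply: (proj1 (sat_conj_all _ _) H); apply: (List.in_map _ _ _ cF).
apply/sat_conj_all => phi /List.in_map_iff[[chi c] [<- cF]] /=.
by rewrite sat_rename E; apply/sat_form_if/H.
Qed.

(** An ird-pattern without dependent types: all rows share one parameter type [W], possibly
    infinite, and consistency is tested on finite lists of index pairs. *)
Definition cut_pattern (L : language) (M : structure L) (X K W : Type)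
    (chi : K -> formula L (X + W)) (c : K -> nat -> W -> M) : Prop :=
  forall (eta : K -> nat) (F : seq (K * nat)), exists x : X -> M,
    forall i j, List.In (i, j) F ->
      (sat (chi i) (env_join x (c i j)) <-> eta i <= j).

Lemma ird_cut_pattern (L : language) (M : structure L) (X K : Type) :
  has_ird_pattern M X K ->
  exists (chi : K -> formula L (X + nat)) c, @cut_pattern L M X K nat chi c.
Proof.
move=> [q [phi [b H]]]; have [m0] := dom_inhabited M.
pose inj i (v : X + 'I_(q i)) : X + nat :=
  match v with inl x => inl x | inr k => inr (k : nat) end.
exists (fun i => rename (inj i) (phi i)).
(* Tuples are padded by [m0] to sequences. *)
exists (fun i j k => if insub k is Some k' then b i j k' else m0) => eta F.
pose p (ij : K * nat) := PFormula (form_if (phi ij.1) (eta ij.1 <= ij.2)) (b ij.1 ij.2).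
have Fsub : p @` [set ij | List.In ij F] `<=` range p by move=> _ [ij _ <-]; exists ij.
have Ffin : finite_set (p @` [set ij | List.In ij F]).
  apply: finite_image; apply/(@finite_seqP {classic (K * nat)}); exists F.
  by apply/seteqP; split=> ij /(@inP {classic (K * nat)}).
have [x xF] := H eta _ Fsub Ffin.
exists x => i j ijF; have := xF (p (i, j)) (ex_intro2 _ _ (i, j) ijF erefl).
rewrite /psat sat_form_if sat_rename /=.
set e := _ \o _; suff -> : e = env_join x (b i j) by [].
by apply/funext => -[y|k] //; rewrite /e /= valK.
Qed.

Lemma cut_pattern_ird (L : language) (M : structure L) (X K K' W : Type)
    (chi : K -> formula L (X + W)) (c : K -> nat -> W -> M) :
  (K -> W) -> cut_pattern chi c -> embeds K' K -> has_ird_pattern M X K'.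
Proof.
move=> w0 cutc [r rinj].
have /choice[q Hq] (i : K') : exists n, exists (psi : formula L (X + 'I_n)) (g : 'I_n -> W),
    forall (x : X -> M) (e : W -> M),
    sat psi (env_join x (e \o g)) = sat (chi (r i)) (env_join x e).
  exact: finite_params (w0 (r i)).
have Hq' (i : K') : {psi : formula L (X + 'I_(q i)) & {g : 'I_(q i) -> W |
    forall (x : X -> M) (e : W -> M),
    sat psi (env_join x (e \o g)) = sat (chi (r i)) (env_join x e)}}.
  by have /cid[psi /cid[g H]] := Hq i; exists psi, g.
exists q, (fun i => projT1 (Hq' i)), (fun i j => c (r i) j \o sval (projT2 (Hq' i))).
move=> eta F Fsub /finite_set_list[s sE].
(* [eta] carried along the injection [r], with 0 at the rows outside its range. *)
have /choice[eta' eta'E] (k : K) : exists n, forall i, r i = k -> n = eta i.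
  have [[i <-]|N] := pselect (exists i, r i = k); first by exists (eta i) => i' /rinj->.
  by exists 0 => i ik; case: N; exists i.
have [l lE] : exists l : seq (K' * nat), forall p, List.In p s ->
    exists2 ij, List.In ij l & PFormula (form_if (projT1 (Hq' ij.1)) (eta ij.1 <= ij.2))
      (c (r ij.1) ij.2 \o sval (projT2 (Hq' ij.1))) = p.
  have : forall p, List.In p s -> F p by move=> p /sE.
  elim: s {sE} => [|p s IH] sF; first by exists [::].
  have [l lE] := IH (fun p ps => sF p (or_intror ps)).
  have [ij _ ijp] := Fsub p (sF p (or_introl erefl)).
  exists (ij :: l) => p' [<-|/lE[ij' ? ?]]; [exists ij|exists ij'] => //; first by left.
  by right.
have [x xP] := cutc eta' [seq (r ij.1, ij.2) | ij <- l].
exists x => p /sE /lE[[i j] ijl <-]; rewrite /psat sat_form_if /=.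
rewrite (svalP (projT2 (Hq' i))) xP; first by rewrite (eta'E _ i erefl).
exact: (List.in_map (fun ij => (r ij.1, ij.2)) _ _ ijl).
Qed.

(** * Cutting an indiscernible array *)

Lemma increasing_extend (j : nat -> rat) (m : nat) :
  (forall n n', n < n' -> n' < m -> (j n < j n')%R) ->
  exists2 j' : nat -> rat, (forall n n', n < n' -> (j' n < j' n')%R) &
    forall n, n < m -> j' n = j n.
Proof.
move=> jinc.
(* Past the first [m] terms, the sequence continues by adding [n] to the last one. *)
exists (fun n => if n < m then j n else (j m.-1 + n%:R)%R) => [n n' nn'|n ->] //.
have [n'm|mn'] := ltnP n' m; first by rewrite (ltn_trans nn' n'm) jinc.
have n'0 : (0 < n'%:R :> rat)%R by rewrite ltr0n; case: (n') nn'.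
have [nm|mn] := ltnP n m; last by rewrite ltrD2l ltr_nat.
have : (j n <= j m.-1)%R.
  have : n <= m.-1 by case: (m) nm.
  rewrite leq_eqVlt => /orP[/eqP->//|/jinc]; case: (m) nm => //= m' _ /(_ (ltnSn _)).
  exact: ltW.
by move: n'0; lra.
Qed.

Lemma increasing_enum (l : seq rat) :
  exists (f : nat -> rat) (idx : rat -> nat) (m : nat),
    (forall n n', n < n' -> (f n < f n')%R) /\
    (forall p, p \in l -> idx p < m /\ f (idx p) = p).
Proof.
pose s := sort <=%R (undup l).
have ss : sorted <%R s by rewrite sort_lt_sorted undup_uniq.
have [n n' nn' n'm|f finc fE] := @increasing_extend (nth 0%R s) (size s).
  by apply: (sorted_ltn_nth lt_trans _ ss); rewrite ?inE ?n'm ?(ltn_trans nn' n'm).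
exists f, (index^~ s), (size s); split=> // p pl.
have ps : p \in s by rewrite mem_sort mem_undup.
by rewrite fE ?nth_index ?index_mem.
Qed.

Lemma increasing_shift (K : Type) (c : K -> rat) :
  increasing (fun i n => n%:R + c i)%R.
Proof. by move=> i n n' nn'; rewrite ltrD2r ltr_nat. Qed.

Lemma increasing_threshold (f : nat -> rat) (m : nat) :
  (forall n n', n < n' -> (f n < f n')%R) ->
  exists2 t, t <= m & forall n, n < m -> (0 <= f n)%R = (t <= n).
Proof.
move=> finc; elim: m => [|m [t tm tE]]; first by exists 0.
have [f0|f0] := boolP (0 <= f m)%R.
  exists t; first exact: leqW.
  by move=> n; rewrite ltnS leq_eqVlt => /orP[/eqP->|/tE//]; rewrite f0 tm.
exists m.+1 => // n nm; rewrite [RHS]leqNgt nm; apply/negP => fn.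
case/negP: f0; apply: le_trans fn _.
by move: nm; rewrite ltnS leq_eqVlt => /orP[/eqP->//|/finc/ltW].
Qed.

Section Witness.
Variables (L : language) (M : structure L) (Kbar : Type).
Hypothesis Msat : saturated M Kbar.
Variables (X : Type) (K : eqType).
Hypothesis smallK : [set: (X + K * rat * nat)%type] #< [set: Kbar].
Variables (chi : K -> formula L (X + nat)) (c : K -> nat -> nat -> M).
Hypothesis chic : cut_pattern chi c.

(** Two passes. The first extracts from the given pattern a mutually indiscernible array, of which
    compactness lets some tuple cut every row at 0. The second makes the halves of the rows mutually
    indiscernible over that tuple and preserves what the first achieved. *)
Lemma indiscernible_cut_pattern : exists (J : K -> rat -> nat -> M) (a : X -> M),
  (forall (phi : formula L (K * nat * nat)) f g, increasing f -> increasing g ->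
    sat phi (sel J f) <-> sat phi (sel J g)) /\
  (forall (phi : formula L (X + K * nat * nat)) f g, increasing f -> increasing g ->
    (forall i n, (0 <= f i n)%R = (0 <= g i n)%R) ->
    sat phi (env_join a (sel J f)) <-> sat phi (env_join a (sel J g))) /\
  (forall i p, sat (chi i) (env_join a (J i p)) <-> (0 <= p)%R).
Proof.
have small0 : [set: (void + K * rat * nat)%type] #< [set: Kbar].
  by apply: card_lt_embeds smallK; exists (fun v => match v with
    | inl x => of_void _ x | inr w => inr w end) => -[[]|x] [[]|y] // [->].
have small1 : [set: (K * rat * nat + X)%type] #< [set: Kbar].
  by apply: card_lt_embeds smallK; exists (fun v => match v with
    | inl x => inr x | inr w => inl w end) => -[x|x] [y|y] // [->].
have [U UU Utail] := ultra_nat.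
have [J [Jind Jem]] := @indiscernible_array L M Kbar Msat void K small0 nat 0
  (fun m n => m < n) (fun=> true) (fun=> true) (fun=> U) (fun=> UU)
  (fun=> filterS (fun _ _ => erefl) filterT)
  (fun _ _ n _ _ => Utail n) c (of_void M).
pose Z (phi : formula L (K * nat * nat)) := rename (@inr void _) phi.
have [ax axP] : exists a : X -> M, forall i p,
    sat (chi i) (env_join a (J i p)) <-> (0 <= p)%R.
  pose h i (p : rat) (v : X + nat) : K * rat * nat + X :=
    match v with inl x => inr x | inr k => inl (i, p, k) end.
  pose S := [set phi | exists i p, phi = rename (h i p) (form_if (chi i) (0 <= p)%R)].
  have E (a : X -> M) i p :
      env_join (fun v : K * rat * nat => J v.1.1 v.1.2 v.2) a \o h i p = env_join a (J i p).
    by apply/funext => -[].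
  have [l lS|a aS] := @saturated_compact L M Kbar Msat _ _ small1 
      (fun v => J v.1.1 v.1.2 v.2) S; last first.
    exists a => i p; apply/sat_form_if; rewrite -E -sat_rename; apply: aS.
    by exists i, p.
  have [F FE] : exists F : seq (K * rat), forall phi, List.In phi l -> exists i p,
      (i, p) \in F /\ phi = rename (h i p) (form_if (chi i) (0 <= p)%R).
    elim: l lS => [|phi l IH] lS; first by exists [::].
    have [F FE] := IH (fun phi pl => lS phi (or_intror pl)).
    have [i [p ip]] := lS phi (or_introl erefl).
    exists ((i, p) :: F) => phi' [<-|/FE[i' [p' [ip' ->]]]].
      by exists i, p; rewrite mem_head.
    by exists i', p'; rewrite in_cons ip' orbT.
  have [f [idx [m [finc idxP]]]] := increasing_enum [seq v.2 | v <- F].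
  have [t tm tE] := increasing_threshold m finc.
  have idxF i p : (i, p) \in F -> idx p < m /\ f (idx p) = p.
    by move=> ip; apply: idxP; apply: (map_f snd) ip.
  pose h' i n (v : X + nat) : X + (void + K * nat * nat) :=
    match v with inl x => inl x | inr k => inr (inr (i, n, k)) end.
  have [psi psiE] := exists_pattern M [seq (rename (h' v.1 (idx v.2)) (chi v.1),
    (0 <= v.2)%R) | v <- F].
  have E' (a : X -> M) s i n :
    env_join a (env_join (of_void M) s) \o h' i n = env_join a (fun k => s (i, n, k)).
    by apply/funext => -[].
  have /psiE[x xF] : sat psi (env_join (of_void M) (sel J (fun=> f))).
    apply: (Jem psi (fun=> f) [seq v.1 | v <- F] m) => [i|j jinc _]; first exact: finc.
    (* [eta i] lies just after entry [t - 1] of the selection, so among the first [m] entries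
       exactly those numbered at least [t], whose rational index is nonnegative, reach it. *)
    apply/psiE; pose eta i := if t is t'.+1 then (j i t').+1 else 0.
    have [x xF] := chic eta [seq (v.1, j v.1 (idx v.2)) | v <- F].
    exists x => _ _ /List.in_map_iff[[i p] [[<- <-] /= ipF]].
    have jF := List.in_map (fun v => (v.1, j v.1 (idx v.2))) _ _ ipF.
    suff <- : (eta i <= j i (idx p)) = (0 <= p)%R.
      by rewrite sat_rename E'; exact: (xF _ _ jF).
    have {}ipF := proj1 (inP _ _) ipF; have [pm fp] := idxF _ _ ipF.
    have iF : i \in [seq v.1 | v <- F] by apply: (map_f fst) ipF.
    rewrite -[in RHS]fp tE //.
    rewrite /eta; case: (t) tm => // t' t'm; have [tp|pt] := ltnP t' (idx p).
      by rewrite jinc.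
    apply/negbTE; rewrite -ltnNge ltnS.
    by move: pt; rewrite leq_eqVlt => /orP[/eqP->//|/(jinc _ _ _ iF) /(_ t'm)/ltnW].
  exists x => phi /FE[i [p [ipF ->]]]; rewrite sat_rename E; apply/sat_form_if.
  have [pm fp] := idxF _ _ ipF.
  have := xF _ _ (List.in_map _ _ _ (proj2 (inP _ _) ipF)).
  by rewrite sat_rename E' /sel /= fp.
have Jind' (phi : formula L (K * nat * nat)) f g : increasing f -> increasing g ->
    sat phi (sel J f) <-> sat phi (sel J g).
  move=> finc ginc; have := Jind (Z phi) f g finc ginc (fun _ _ => erefl).
  by rewrite !sat_rename.
pose lab (p : rat) := (0 <= p)%R.
have [V [VU Vlab Vlt]] := ultra_rat.
(* Second pass: over [ax], with one ultrafilter for each side of the cut. *)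
have [J' [J'ind J'em]] := @indiscernible_array L M Kbar Msat X K smallK rat 0%R
  (fun p p' => (p < p')%R) lab lab V VU (fun p => Vlab (lab p))
  (fun p p' x pp' xp => Vlt (lab p') x (fun x0 =>
    ltW (le_lt_trans (etrans (esym xp) x0) pp'))) J ax.
exists J', ax; split; [|split=> //].
  move=> phi f g finc ginc.
  pose f0 (i : K) (n : nat) := (n%:R + 0 : rat)%R.
  have f0inc : increasing f0 by exact: increasing_shift.
  suff gen h : increasing h -> sat phi (sel J' h) <-> sat phi (sel J f0) by rewrite !gen.
  move=> hinc.
  have pres (phi' : formula L (K * nat * nat)) : sat phi' (sel J f0) -> sat phi' (sel J' h).
    move=> H; pose psi := rename (@inr X _) phi'.
    suff : sat psi (env_join ax (sel J' h)) by rewrite sat_rename.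
    have [lK [m supp]] := array_support_nat M psi.
    apply: (J'em psi h lK m hinc) => j jinc _.
    (* [j] increases only on finitely many rows and entries; it is modified elsewhere so that the
       indiscernibility of [J] applies. *)
    have /choice[j' j'P] (i : K) : exists j' : nat -> rat,
        (forall n n', n < n' -> (j' n < j' n')%R) /\
        (i \in lK -> forall n, n < m -> j' n = j i n).
      have [il|_] := boolP (i \in lK); last first.
        by exists (f0 i); split=> // n n'; exact: f0inc.
      by have [n n'|j' ? ?] := @increasing_extend (j i) m; [exact: jinc|exists j'].
    rewrite (supp _ _ (sel J j')).
      rewrite sat_rename; apply: (proj1 (Jind' phi' f0 j' f0inc _)) => //.
      by move=> i n n'; apply: (j'P i).1.
    by move=> i n k il nm; rewrite /sel /= (j'P i).2.
  split=> [H|]; last exact: pres.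
  by apply: contrapT => /(pres (Not phi)).
move=> i p; pose h (v : X + nat) : X + K * nat * nat :=
  match v with inl x => inl x | inr k => inr (i, 0, k) end.
have E (B : K -> rat -> nat -> M) j : env_join ax (sel B j) \o h = env_join ax (B i (j i 0)).
  by apply/funext => -[].
(* Chosen so that entry 0 of each row has index [p]. *)
pose f0 (i : K) (n : nat) := (n%:R + p : rat)%R.
have f0i : f0 i 0 = p by rewrite /f0 add0r.
rewrite -{1}f0i -E -sat_rename; apply/sat_form_if.
have -> : form_if (rename h (chi i)) (0 <= p)%R = rename h (form_if (chi i) (0 <= p)%R).
  by case: (0 <= p)%R.
apply: (J'em _ f0 [:: i] 1); first exact: increasing_shift.
move=> j _ jlab; rewrite sat_rename E; apply/sat_form_if.
by rewrite axP -f0i -/(lab _) jlab ?mem_head.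
Qed.

End Witness.

(** * Rows cut by [x0] *)

Section Dichotomy.
Variables (L : language) (M : structure L) (X0 X1 : Type) (K : eqType).
Variables (chi : K -> formula L ((X0 + X1) + nat)).
Variables (J : K -> rat -> nat -> M) (a : X0 + X1 -> M).
Hypothesis Jind : forall (phi : formula L (K * nat * nat)) f g,
  increasing f -> increasing g -> sat phi (sel J f) <-> sat phi (sel J g).
Hypothesis Jinda : forall (phi : formula L ((X0 + X1) + K * nat * nat)) f g,
  increasing f -> increasing g ->
  (forall i n, (0 <= f i n)%R = (0 <= g i n)%R) ->
  sat phi (env_join a (sel J f)) <-> sat phi (env_join a (sel J g)).
Hypothesis Jcut : forall i p, sat (chi i) (env_join a (J i p)) <-> (0 <= p)%R.

Let a0 : X0 -> M := a \o inl.
Let a1 : X1 -> M := a \o inr.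

Let Jinda0 (phi : formula L (X0 + K * nat * nat)) f g :
  increasing f -> increasing g -> (forall i n, (0 <= f i n)%R = (0 <= g i n)%R) ->
  sat phi (env_join a0 (sel J f)) <-> sat phi (env_join a0 (sel J g)).
Proof.
move=> finc ginc fg.
pose h (v : X0 + K * nat * nat) : (X0 + X1) + K * nat * nat :=
  match v with inl x => inl (inl x) | inr w => inr w end.
have E s : env_join a s \o h = env_join a0 s by apply/funext => -[].
by have := Jinda (rename h phi) finc ginc fg; rewrite !sat_rename !E.
Qed.

(** The finitely many indices that occur are listed increasingly; a shift of each row by its own
    amount keeps their order, so indiscernibility applies. *)
Let Jshift (phi : formula L (K * rat * nat)) (s : K -> rat) :
  sat phi (sel J (fun i p => p)) <-> sat phi (sel J (fun i p => p - s i)%R).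
Proof.
pose psi := rename (@inr void _) phi.
have [lK [lW supp]] := array_support M psi.
have suppW (s1 s2 : K * rat * nat -> M) :
    (forall i w k, w \in lW -> s1 (i, w, k) = s2 (i, w, k)) ->
    sat phi s1 = sat phi s2.
  move=> s12; have := supp (of_void M) s1 s2 (fun i w k _ => @s12 i w k).
  by rewrite !sat_rename.
have [f [idx [m [finc idxP]]]] := increasing_enum lW.
pose h (v : K * rat * nat) := (v.1.1, idx v.1.2, v.2).
have -> : sat phi (sel J (fun i p => p)) = sat (rename h phi) (sel J (fun=> f)).
  by rewrite sat_rename; apply: suppW => i w k wl; rewrite /sel /= (idxP w wl).2.
have -> : sat phi (sel J (fun i p => p - s i)%R) =
    sat (rename h phi) (sel J (fun i n => f n - s i)%R).
  by rewrite sat_rename; apply: suppW => i w k wl; rewrite /sel /= (idxP w wl).2.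
by apply: Jind => i n n' nn'; rewrite ?ltrD2r finc.
Qed.

(* Row [i] is indiscernible over [a0] and the two halves of the other rows. *)
Definition uncut (i : K) : Prop :=
  forall (phi : formula L (X0 + K * nat * nat)) f g, increasing f -> increasing g ->
    (forall i' n, i' != i -> (0 <= f i' n)%R = (0 <= g i' n)%R) ->
    sat phi (env_join a0 (sel J f)) <-> sat phi (env_join a0 (sel J g)).

(** [f] is changed into [g] one row of the support at a time: an uncut row is free to move, and a
    cut one keeps its entries on their side of 0. *)
Lemma uncut_all (phi : formula L (X0 + K * nat * nat)) f g :
  increasing f -> increasing g ->
  (forall i n, ~ uncut i -> (0 <= f i n)%R = (0 <= g i n)%R) ->
  sat phi (env_join a0 (sel J f)) <-> sat phi (env_join a0 (sel J g)).
Proof.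
move=> finc ginc fg; have [lK [m supp]] := array_support_nat M phi.
pose mix (l : seq K) i := if i \in l then g i else f i.
have mixinc l : increasing (mix l).
  by move=> i n n' nn'; rewrite /mix; case: ifP => _; [exact: ginc|exact: finc].
rewrite (supp _ (sel J g) (sel J (mix lK))); last first.
  by move=> i n k il _; rewrite /sel /mix /= il.
elim: (lK) => [|i l IH]; first by rewrite /mix.
rewrite IH; have [ui|Nui] := pselect (uncut i).
  apply: ui => // i' n i'i.
  by rewrite /mix in_cons (negbTE i'i).
apply: Jinda0 => // i' n; rewrite /mix in_cons.
by case: eqP => [->|//]; case: ifP => //= _; exact: fg.
Qed.

(** The formulas are [chi i] with [a0] moved among the parameters. Over [a0] the uncut rows may be
    shifted independently, so any pattern [eta] reduces to the one that [a1] realizes. *)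
Lemma uncut_pattern :
  exists (chi' : {i | uncut i} -> formula L (X1 + (X0 + nat))) c,
  cut_pattern (M := M) chi' c.
Proof.
pose r (v : (X0 + X1) + nat) : X1 + (X0 + nat) := match v with
  | inl (inl x) => inr (inl x) | inl (inr x) => inl x | inr k => inr (inr k) end.
exists (fun i => rename r (chi (sval i))).
exists (fun i j => env_join a0 (J (sval i) j%:R%R)) => eta F.
have /choice[eta' eta'E] (k : K) : exists n, forall i, sval i = k -> n = eta i.
  have [u|N] := pselect (uncut k); last by exists 0 => -[i u] /= ik; case: N; rewrite -ik.
  by exists (eta (exist _ k u)) => -[i u'] /= ik; congr eta; exact: eq_exist.
have E s x : env_join x (env_join a0 s) \o r =
    env_join (fun v => match v with inl x0 => a0 x0 | inr x1 => x x1 end) s.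
  by apply/funext => -[[]|].
pose h i (n : nat) (v : (X0 + X1) + nat) : X1 + (X0 + K * nat * nat) := match v with
  | inl (inl x) => inr (inl x) | inl (inr x) => inl x | inr k => inr (inr (i, n, k)) end.
have [psi psiE] := exists_pattern M
  [seq (rename (h (sval v.1) v.2) (chi (sval v.1)), eta v.1 <= v.2) | v <- F].
have Eh f x i n : env_join x (env_join a0 (sel J f)) \o h i n =
    env_join (fun v => match v with inl x0 => a0 x0 | inr x1 => x x1 end) (J i (f i n)).
  by apply/funext => -[[]|].
have aE : (fun v => match v with inl x0 => a0 x0 | inr x1 => a1 x1 end) = a.
  by apply/funext => -[].
pose g (i : K) (n : nat) := (n%:R + 0 : rat)%R.
(* Shifting row [i] by [eta i] puts its entry [n] right of the cut exactly when [eta i <= n]. *)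
pose f i (n : nat) := (n%:R + if `[< uncut i >] then - (eta' i)%:R else 0 : rat)%R.
have /psiE[x xF] : sat psi (env_join a0 (sel J g)).
  apply: (proj1 (@uncut_all psi f g _ _ _)); try exact: increasing_shift.
    by move=> i n /asboolPn /negbTE H; rewrite /f H.
  apply/psiE; exists a1 => _ _ /List.in_map_iff[[i j] [[<- <-] _]] /=.
  rewrite sat_rename Eh aE Jcut /f; case: i => i u /=.
  by rewrite (asboolT u) subr_ge0 ler_nat (eta'E _ (exist _ i u) erefl).
exists x => i j ijF; rewrite sat_rename E.
have := xF _ _ (List.in_map _ _ _ ijF); rewrite sat_rename Eh /g addr0.
by [].
Qed.

(** A failure of [uncut] yields a formula whose truth changes when exactly one entry, number [t] of
    row [i], crosses 0. That entry is put at [y] and all others at distance at least 1 from 0, so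
    that shifts by less than 1 can move it alone across the cut. *)
Lemma cut_formula i : ~ uncut i ->
  exists (theta : formula L (X0 + K * nat * nat)) (pos : rat -> K -> nat -> rat),
  forall (s : K -> rat) y, (forall i', 0 <= s i' < 1)%R -> (0 <= y < 1)%R ->
    sat theta (env_join a0 (sel J (fun i' n => pos y i' n - s i')%R)) <-> (s i <= y)%R.
Proof.
move=> /existsNP[phi /existsNP[f /existsNP[g]]].
move=> /not_implyP[finc /not_implyP[ginc /not_implyP[fg Nfg]]].
(* In [H t], exactly the entries [n < t] of row [i] lie left of the cut. *)
pose H (t : nat) i' (n : nat) := if i' == i then (n%:R - t%:R)%R else f i' n.
have Hinc t : increasing (H t).
  by move=> i' n n' nn'; rewrite /H; case: eqP => _; [rewrite ltrD2r ltr_nat|exact: finc].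
pose T t := sat phi (env_join a0 (sel J (H t))).
have toH h : increasing h ->
      (forall i' n, i' != i -> (0 <= h i' n)%R = (0 <= f i' n)%R) ->
    exists t, sat phi (env_join a0 (sel J h)) <-> T t.
  move=> hinc hf; have [lK [m supp]] := array_support_nat M phi.
  have [t tm tE] := increasing_threshold m (hinc i).
  (* Beyond the support, the entries of row [i] are pushed to the right of 0, which makes the
     threshold [t] valid for all [n]. *)
  exists t; pose h' i' n :=
    if (i' == i) && (m <= n) then (n%:R + Num.max (h i m) 0)%R else h i' n.
  rewrite (supp _ _ (sel J h')); last first.
    by move=> i' n k _ nm; rewrite /sel /h' /= [m <= n]leqNgt nm andbF.
  have max0 : (0 <= Num.max (h i m) 0)%R by rewrite le_max lexx orbT.
  have maxm : (h i m <= Num.max (h i m) 0)%R by rewrite le_max lexx.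
  apply: Jinda0 => // [i' n n' nn'|i' n]; rewrite /h' ?/H.
    case: eqP => [->|_] /=; last exact: hinc.
    have [mn|nm] := leqP m n.
      by rewrite (leq_trans mn (ltnW nn')) ltrD2r ltr_nat.
    have [mn'|n'm] := leqP m n'; last exact: hinc.
    have := hinc i _ _ nm; have : (0 <= n'%:R :> rat)%R by rewrite ler0n.
    by move: maxm; lra.
  case: eqP => [->|/eqP i'i] /=; last exact: hf.
  rewrite subr_ge0 ler_nat; have [mn|nm] := leqP m n; last exact: tE.
  by rewrite (leq_trans tm mn) addr_ge0.
(* If [T] were constant, [phi] would have the same truth value at [f] and at [g]. *)
have [t Nt] : exists t, ~ (T t <-> T t.+1).
  apply: contrapT => /forallNP HT.
  have [t1 E1] := toH f finc (fun _ _ _ => erefl).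
  have [t2 E2] := toH g ginc (fun i' n i'i => esym (fg i' n i'i)).
  have T0 t : T t <-> T 0.
    by elim: t => // t IH; rewrite -IH; have /contrapT[] := HT t.
  by apply: Nfg; rewrite E1 E2 !T0.
(* Keeps sign and order, and leaves a gap around 0 wider than any allowed shift. *)
pose out (p : rat) := if (0 <= p)%R then (p + 1)%R else (p - 1)%R.
pose pos y i' (n : nat) := if i' == i then
  (if n == t then y else if (n < t)%N then n%:R - t%:R - 1 else n%:R - t%:R : rat)%R
  else out (f i' n).
have posinc y (s : K -> rat) : (0 <= y < 1)%R ->
    increasing (fun i' n => pos y i' n - s i')%R.
  move=> y01 i' n n' nn'; rewrite ltrD2r /pos.
  have ltn_rat (n1 n2 : nat) : n1 < n2 -> (n1%:R + 1 <= n2%:R :> rat)%R.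
    by move=> uv; rewrite natr1 ler_nat.
  case: eqP => [_|_]; last first.
    by have := finc i' _ _ nn'; rewrite /out; case: ifP; case: ifP; lra.
  have N1 := ltn_rat _ _ nn'.
  have [nt|tn|ntE] := ltngtP n t; have [n't|tn'|n'tE] := ltngtP n' t;
    try (have N2 := ltn_rat _ _ nt); try (have N3 := ltn_rat _ _ tn);
    try (have N4 := ltn_rat _ _ n't); try (have N5 := ltn_rat _ _ tn'); subst; lra.
have poslab y (s : K -> rat) (u n : nat) : (forall i', 0 <= s i' < 1)%R ->
    (0 <= y < 1)%R -> (u = t + (y < s i)%R) ->
    forall i', (0 <= pos y i' n - s i')%R = (0 <= H u i' n)%R.
  move=> s01 y01 -> i'; have {s01} s01 := s01 i'; rewrite /pos /H.
  case: eqP s01 => [->|_] s01; last by rewrite /out; case: ifP => f0; apply/idP/idP; lra.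
  rewrite subr_ge0 [RHS]subr_ge0 ler_nat.
  have ltn_rat (n1 n2 : nat) : n1 < n2 -> (n1%:R + 1 <= n2%:R :> rat)%R.
    by move=> uv; rewrite natr1 ler_nat.
  have [nt|tn|->] := ltngtP n t.
  - have N := ltn_rat _ _ nt; rewrite leqNgt (leq_trans nt (leq_addr _ _)) /=.
    by apply/negbTE; rewrite -ltNge; lra.
  - have N := ltn_rat _ _ tn.
    have -> : t + (y < s i)%R <= n by case: (y < s i)%R; rewrite ?addn1 ?addn0 // ltnW.
    by lra.
  - by rewrite leNgt; case: (y < s i)%R; rewrite ?addn1 ?addn0 ?leqnn ?ltnn.
have sT y (s : K -> rat) : (forall i', 0 <= s i' < 1)%R -> (0 <= y < 1)%R ->
    sat phi (env_join a0 (sel J (fun i' n => pos y i' n - s i')%R)) <-> T (t + (y < s i)%R).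
  by move=> s01 y01; apply: Jinda0 => // [|i' n]; [exact: posinc|exact: poslab].
(* Entry [t] ends right of the cut iff [s i <= y], which gives [T t], and left of it otherwise,
   which gives [T t.+1]. The sign makes the formula true in the first case. *)
exists (if `[< T t >] then phi else Not phi), pos => s y s01 y01.
have := sT y s s01 y01; rewrite leNgt.
have falseE : is_true false <-> False by [].
have trueE : is_true true by [].
have NT : T t.+1 <-> ~ T t by have [] := pselect (T t); have [] := pselect (T t.+1); tauto.
by case: asboolP => Tt; case: (y < s i)%R; rewrite /= ?addn0 ?addn1 => H1; tauto.
Qed.

(** The moving entries sit at the points [y j = 1 - 1 / (j + 1)] of [0, 1[. Once each row is shifted
    by [y (eta i)], [a0] realizes the pattern [eta], because [y (eta i) <= y j] iff [eta i <= j]. *)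
Lemma cut_pattern_cut :
  exists (chi' : {i | ~ uncut i} -> formula L (X0 + K * nat * nat)) c,
  cut_pattern (M := M) chi' c.
Proof.
have /choice[thpos thposP] (k : {i | ~ uncut i}) :
  exists tp : formula L (X0 + K * nat * nat) * (rat -> K -> nat -> rat),
  forall (s : K -> rat) y, (forall i', 0 <= s i' < 1)%R -> (0 <= y < 1)%R ->
    sat tp.1 (env_join a0 (sel J (fun i' n => tp.2 y i' n - s i')%R)) <-> (s (sval k) <= y)%R.
  by have [theta [pos H]] := cut_formula (svalP k); exists (theta, pos).
pose y (j : nat) := (1 - j.+1%:R^-1 : rat)%R.
have y01 j : (0 <= y j < 1)%R.
  by rewrite subr_ge0 invf_le1 ?ltr0n // ler1n /= gtrBl invr_gt0 ltr0n.
have yle j j' : (y j <= y j')%R = (j <= j').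
  by rewrite lerD2l lerN2 lef_pV2 ?posrE ?ltr0n // ler_nat.
exists (fun k => (thpos k).1), (fun k j => sel J ((thpos k).2 (y j))) => eta F.
have /choice[eta' eta'E] (k : K) : exists n, forall i, sval i = k -> n = eta i.
  have [u|N] := pselect (~ uncut k); last by exists 0 => -[i u] /= ik; case: N; rewrite -ik.
  by exists (eta (exist _ k u)) => -[i u'] /= ik; congr eta; exact: eq_exist.
pose h k j (v : X0 + K * nat * nat) : X0 + K * rat * nat :=
  selV ((thpos k).2 (y j)) v.
have [psi psiE] := exists_pattern M
  [seq (rename (h v.1 v.2) (thpos v.1).1, eta v.1 <= v.2) | v <- F].
have E f x k j : env_join x (sel J f) \o h k j =
    env_join x (sel J (fun i n => f i ((thpos k).2 (y j) i n))).
  by apply/funext => -[].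
(* [psi] quantifies the [x0]-variables, so it speaks of the array alone and is invariant under
   shifts. *)
have /psiE[x xF] : sat psi (sel J (fun=> id)).
  apply: (proj2 (Jshift psi (fun i => y (eta' i)))).
  apply/psiE; exists a0 => _ _ /List.in_map_iff[[k j] [[<- <-] _]] /=.
  rewrite sat_rename E thposP // yle (eta'E _ k erefl).
  by [].
exists x => k j kjF; have := xF _ _ (List.in_map _ _ _ kjF).
by rewrite sat_rename E.
Qed.

End Dichotomy.

(** * Counting the cut and the uncut rows *)

Theorem theorem3p3 (L : language) (T : set (sentence L))
    (Tcomplete : complete_theory T)
    (Tinfinite : exists N : structure L, models N T /\ infinite_set [set: N])
    (Kbar : Type) (M : structure L) (Mmonster : monster M T Kbar)
    (K K0 K1 : Type)
    (Ksmall : [set: K] #< [set: Kbar])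
    (Ksum : [set: (K + unit)%type] #= [set: (K0 + K1)%type])
    (p0 p1 : nat) :
  has_ird_pattern M ('I_p0 + 'I_p1)%type K ->
  has_ird_pattern M 'I_p0 K0 \/ has_ird_pattern M 'I_p1 K1.
Proof.
move=> /ird_cut_pattern[chi [c chic]]; have [_ lang Msat _] := Mmonster.
have nat_small : [set: nat] #< [set: Kbar].
  by apply: card_lt_embeds lang; exists (fun n => Eq (Var L n) (Var L n)) => m n [].
have small : [set: (('I_p0 + 'I_p1) + {classic K} * rat * nat)%type] #< [set: Kbar].
  pose C := (('I_p0 + 'I_p1) + rat * nat)%type.
  have Cnat : embeds C nat by exists pickle; exact: pcan_inj pickleK.
  apply: card_lt_embeds (card_lt_option_prod Cnat nat_small Ksmall).
  exists (fun v => match v with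
    | inl x => (None, inl x) | inr w => (Some w.1.1, inr (w.1.2, w.2)) end).
  by move=> [x|[[i p] k]] [x'|[[i' p'] k']] //= []; [move=> ->|move=> -> -> ->].
have [J [a [Jind [Jinda Jcut]]]] :=
  indiscernible_cut_pattern Msat small (chic : cut_pattern (K := {classic K}) chi c).
have le01K : embeds (K0 + K1) (option K).
  apply: (@embeds_trans _ (K + unit)); last first.
    by exists (fun v => if v is inl x then Some x else None) => -[x|[]] [y|[]] // [->].
  by apply/card_le_embeds; move: Ksum; rewrite card_eq_sym => /card_eqPle[].
have leK01 : embeds (option K) (K0 + K1).
  apply: (@embeds_trans _ (K + unit)).
    by exists (fun o => if o is Some x then inl x else inr tt) => -[x|] [y|] // [->].
  by apply/card_le_embeds; move: Ksum => /card_eqPle[].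
(* The set that is split off consists of the rows cut by [a0]; its complement is the set of uncut
   rows up to a double negation. *)
have [cutK0|uncutK1] := sum_cardinal_split
    (fun i : K => ~ uncut (K := {classic K}) (X1 := 'I_p1) J a i) le01K leK01.
  left; have [chi' [c' c'P]] := cut_pattern_cut Jind Jinda.
  by apply: cut_pattern_ird c'P cutK0 => k; exact: ((sval k, 0), 0).
right; have [chi' [c' c'P]] := uncut_pattern Jinda Jcut.
apply: (cut_pattern_ird _ c'P) => [k|]; first exact: (inr 0).
apply: embeds_trans uncutK1 _.
exists (fun k => exist _ (sval k) (contrapT (svalP k))) => k k' /(congr1 sval) /= kk'.
exact: eq_sig_hprop.
Qed.
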